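(* The variety $\mathbf{P}_3$ of $3$-dimensional complex Poisson algebras has exactly six irreducible components, namely $\overline{O(\mathcal{P}_{3,5})}$, $\overline{O(\mathcal{P}_{3,7})}$, $\overline{O(\mathcal{P}_{3,18})}$, $\overline{O(\mathcal{P}_{3,20})}$, $\overline{\bigcup_{\alpha\in\mathbb{C}}O(\mathcal{P}_{3,4}^{\alpha})}$ and $\overline{\bigcup_{\alpha\in\mathbb{C}}O(\mathcal{P}_{3,16}^{\alpha})}$, where (basis $e_1,e_2,e_3$, only nonzero products listed up to commutativity of $\cdot$ and anticommutativity of $\{-,-\}$): $\mathcal{P}_{3,4}^{\alpha}$: $\{e_1,e_2\}=e_2,\{e_1,e_3\}=\alpha e_3$; $\mathcal{P}_{3,5}$: $\{e_1,e_2\}=e_3,\{e_1,e_3\}=-2e_1,\{e_2,e_3\}=2e_2$; $\mathcal{P}_{3,7}$: $e_1\cdot e_1=e_1,e_2\cdot e_2=e_2,e_3\cdot e_3=e_3$; $\mathcal{P}_{3,16}^{\alpha}$: $e_1\cdot e_2=e_3,\{e_1,e_2\}=\alpha e_3$; $\mathcal{P}_{3,18}$: $e_1\cdot e_1=e_1,e_1\cdot e_2=e_2,e_1\cdot e_3=e_3,\{e_2,e_3\}=e_2$; $\mathcal{P}_{3,20}$: $e_1\cdot e_1=e_1,\{e_2,e_3\}=e_2$.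
   Context: A Poisson algebra has a commutative associative product $\cdot$ and a Lie bracket $\{-,-\}$ with $\{x\cdot y,z\}=\{x,z\}\cdot y+x\cdot\{y,z\}$. Fix a $3$-dimensional complex vector space $V$; pairs $(\mu,\mu')$ of bilinear maps on $V$ are identified with their structure constants in $\mathbb{C}^{54}$, and $\mathbf{P}_3$ is the affine variety of pairs defining Poisson algebras. $\mathrm{GL}(V)$ acts by $(g*(\mu,\mu'))(x,y)=(g\mu(g^{-1}x,g^{-1}y),g\mu'(g^{-1}x,g^{-1}y))$, and $O(\mathcal{P})$ is the orbit of a structure representing $\mathcal{P}$. Closures are Zariski closures. *)

(* Defs.v *)
From mathcomp Require Import all_boot all_algebra.
From mathcomp Require Import complex.
From mathcomp Require Import Rstruct.
From mathcomp Require Import mpoly.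
Set Implicit Arguments. Unset Strict Implicit. Unset Printing Implicit Defensive.
Import GRing.Theory.
Local Open Scope ring_scope.

Definition C : closedFieldType := complex Rdefinitions.R.

(** Points of the affine space C^54 (structure constants of pairs (mu, mu')). *)
Definition Pt := 'I_54 -> C.

(** Coordinate of the structure constant: [idx b i j k] is the coordinate of
    the coefficient of e_k in mu(e_i,e_j) (b = false) resp. mu'(e_i,e_j)
    (b = true).  This is a bijection ('I_2 * 'I_3^3 -> 'I_54). *)
Definition idx (b : bool) (i j k : 'I_3) : 'I_54 :=
  inord (b * 27 + i * 9 + j * 3 + k)%N.

(** Structure constants: m i j k = coefficient of e_k in m(e_i, e_j). *)
Definition consts := 'I_3 -> 'I_3 -> 'I_3 -> C.

Definition bil (m : consts) (u v : 'cV[C]_3) : 'cV[C]_3 :=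
  \col_k \sum_i \sum_j u i 0 * v j 0 * m i j k.

Definition is_poisson (m b : consts) : Prop :=
  forall x y z : 'cV[C]_3,
    [/\ bil m x y = bil m y x,
        bil m (bil m x y) z = bil m x (bil m y z),
        bil b x x = 0,
        bil b x (bil b y z) + bil b y (bil b z x) + bil b z (bil b x y) = 0
      & bil b (bil m x y) z = bil m (bil b x z) y + bil m x (bil b y z)].

Definition pt_mul (x : Pt) : consts := fun i j k => x (idx false i j k).
Definition pt_br (x : Pt) : consts := fun i j k => x (idx true i j k).

Definition P3 : Pt -> Prop := fun x => is_poisson (pt_mul x) (pt_br x).

Definition act (g : 'M[C]_3) (m : consts) : consts := fun i j k =>
  (g *m bil m (invmx g *m delta_mx i 0) (invmx g *m delta_mx j 0)) k 0.

Definition orbit (m b : consts) : Pt -> Prop := fun x =>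
  exists g : 'M[C]_3, g \in unitmx /\
    forall i j k, x (idx false i j k) = act g m i j k /\
                  x (idx true i j k) = act g b i j k.

Definition zero_locus (S : {mpoly C[54]} -> Prop) : Pt -> Prop :=
  fun x => forall p, S p -> p.@[x] = 0.

Definition set_eq (A B : Pt -> Prop) : Prop := forall x, A x <-> B x.
Definition subset (A B : Pt -> Prop) : Prop := forall x, A x -> B x.

Definition zclosed (A : Pt -> Prop) : Prop :=
  exists S, set_eq A (zero_locus S).

Definition zclosure (A : Pt -> Prop) : Pt -> Prop :=
  fun x => forall B, zclosed B -> subset A B -> B x.

Definition irreducible (A : Pt -> Prop) : Prop :=
  (exists x, A x) /\
  forall F1 F2, zclosed F1 -> zclosed F2 ->
    subset A (fun x => F1 x \/ F2 x) -> subset A F1 \/ subset A F2.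

Definition irr_component (X A : Pt -> Prop) : Prop :=
  [/\ subset A X, irreducible A &
      forall B, irreducible B -> subset A B -> subset B X -> set_eq B A].

(** Building structure constants from lists of nonzero products
    (a, b, c, coeff) meaning  e_a * e_b = coeff e_c  (summed). *)
Definition mk_sym (l : seq (nat * nat * nat * C)) : consts := fun i j k =>
  \sum_(t <- l)
    (if ((((i : nat) == t.1.1.1) && ((j : nat) == t.1.1.2))
         || (((i : nat) == t.1.1.2) && ((j : nat) == t.1.1.1)))
        && ((k : nat) == t.1.2) then t.2 else 0).

Definition mk_skew (l : seq (nat * nat * nat * C)) : consts := fun i j k =>
  \sum_(t <- l)
    ((if [&& (i : nat) == t.1.1.1, (j : nat) == t.1.1.2 & (k : nat) == t.1.2]
      then t.2 else 0)
   - (if [&& (i : nat) == t.1.1.2, (j : nat) == t.1.1.1 & (k : nat) == t.1.2]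
      then t.2 else 0)).

Definition entry (a b c : nat) (x : C) : nat * nat * nat * C := (a, b, c, x).
Arguments entry a%_N b%_N c%_N x%_R.

Definition zero_c : consts := fun _ _ _ => 0.

(* basis e_1, e_2, e_3 is indexed 0, 1, 2 *)
Definition P34_mul (a : C) : consts := zero_c.
Definition P34_br (a : C) : consts := mk_skew [:: entry 0 1 1 (1); entry 0 2 2 (a)].
Definition P35_mul : consts := zero_c.
Definition P35_br : consts :=
  mk_skew [:: entry 0 1 2 (1); entry 0 2 0 (-2); entry 1 2 1 (2)].
Definition P37_mul : consts := mk_sym [:: entry 0 0 0 (1); entry 1 1 1 (1); entry 2 2 2 (1)].
Definition P37_br : consts := zero_c.
Definition P316_mul (a : C) : consts := mk_sym [:: entry 0 1 2 (1)].
Definition P316_br (a : C) : consts := mk_skew [:: entry 0 1 2 (a)].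
Definition P318_mul : consts := mk_sym [:: entry 0 0 0 (1); entry 0 1 1 (1); entry 0 2 2 (1)].
Definition P318_br : consts := mk_skew [:: entry 1 2 1 (1)].
Definition P320_mul : consts := mk_sym [:: entry 0 0 0 (1)].
Definition P320_br : consts := mk_skew [:: entry 1 2 1 (1)].

Definition comp1 : Pt -> Prop := zclosure (orbit P35_mul P35_br).
Definition comp2 : Pt -> Prop := zclosure (orbit P37_mul P37_br).
Definition comp3 : Pt -> Prop := zclosure (orbit P318_mul P318_br).
Definition comp4 : Pt -> Prop := zclosure (orbit P320_mul P320_br).
Definition comp5 : Pt -> Prop :=
  zclosure (fun x => exists a : C, orbit (P34_mul a) (P34_br a) x).
Definition comp6 : Pt -> Prop :=
  zclosure (fun x => exists a : C, orbit (P316_mul a) (P316_br a) x).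

Definition comps : seq (Pt -> Prop) := [:: comp1; comp2; comp3; comp4; comp5; comp6].

(* Main.v *)
Require Import Defs.
From mathcomp Require Import all_boot all_algebra complex Rstruct ring zify mpoly.
From Stdlib Require Import Classical FunctionalExtensionality PropExtensionality.
Set Implicit Arguments. Unset Strict Implicit. Unset Printing Implicit Defensive.
Import GRing.Theory Num.Theory Defs.
Local Open Scope ring_scope.

(* Every point of P_3 is a limit of points of the six families. Let x vary in a
   Poisson algebra A.
   - If x, x^2, x^3 are independent for some x, then A = T C[T]/(T p(T)) with p a
     cubic, the bracket vanishes, and making the roots of p distinct and nonzero
     gives C^3 = P_{3,7}.
   - Otherwise det(x, x^2, x^3) vanishes identically. If A has an idempotent u,
     expanding this identity at x = u + s y shows that A is either C u times a
     null algebra (P_{3,20}) or C u + m with m^2 = 0 (P_{3,18}). If not, x^3 = 0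
     for all x, so A^3 = 0 and A is a limit of some P_{3,16}^a or of P_{3,20}.
   - If the product is zero, the bracket is M (y x z) for a matrix M whose skew
     part has axial vector a, and Jacobi's identity reads M a = 0. If a = 0, a
     generic symmetric perturbation of M is nondegenerate (P_{3,5}); otherwise
     the plane orthogonal to a is an abelian ideal (P_{3,4}^a).
   The closures are irreducible because any two points of GL_3 x C are joined by
   a line, and they are pairwise incomparable by polynomial invariants. *)

(** No limit is ever taken. Over an infinite field, a polynomial that vanishes wherever some nonzero
    polynomial [e] does not vanish is zero. So a degeneration is a polynomial curve of structure
    constants in a fixed basis, whose members lie in the required orbits wherever [e] is nonzero.
    Usually the parameters run linearly from those of the given algebra at [t = 0] to a
    nondegenerate choice at [t = 1], where [e] is visibly nonzero. The same principle at [s = 0]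
    extracts the lowest coefficient of the expanded determinant identity, after column operations
    have divided out the power of [s]. Irreducibility needs curves with poles, because the action
    involves the inverse matrix: these are rational functions whose poles lie at the zeros of a
    fixed polynomial. The separating invariants are identities quantified over all vectors. This
    makes each of them a Zariski closed condition stable under change of basis, to be tested at one
    point per component. *)

Lemma natC_neq0 (n : nat) : (n.+1%:R : C) != 0.
Proof. by have := @pnatr_eq0 (complex Rdefinitions.R) n.+1; rewrite /C => ->. Qed.

(** * Polynomial functions and the Zariski topology *)

(** Abstracts what polynomial functions of [t], polynomial functions of the 54 coordinates and
    rational functions of [t] share, so that determinants, [bil] and evaluation of polynomials are
    treated once for all three. *)
Definition funalg (T : Type) (P : (T -> C) -> Prop) :=
  [/\ forall c, P (fun=> c),
      forall f g, P f -> P g -> P (fun x => f x + g x)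
    & forall f g, P f -> P g -> P (fun x => f x * g x)].

(** Serves as rewriting under the binder: with [g] left open, the goal [f x = g x] is rewritten
    until it determines [g]. *)
Lemma fun_transfer (T U : Type) (P : (T -> U) -> Prop) g f : f =1 g -> P g -> P f.
Proof. by move=> /functional_extensionality ->. Qed.

Section FunAlg.
Variables (T : Type) (P : (T -> C) -> Prop).
Hypothesis algP : funalg P.

Lemma funalg_cst c : P (fun=> c). Proof. by case: algP. Qed.

Lemma funalgD f g : P f -> P g -> P (fun x => f x + g x).
Proof. by case: algP => _ + _; apply. Qed.

Lemma funalgM f g : P f -> P g -> P (fun x => f x * g x).
Proof. by case: algP => _ _; apply. Qed.

Lemma funalgN f : P f -> P (fun x => - f x).
Proof.
move=> Pf; apply: fun_transfer (funalgM (funalg_cst (-1)) Pf) => x.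
by rewrite mulN1r.
Qed.

Lemma funalg_sum (I : Type) (r : seq I) (Q : pred I) (F : I -> T -> C) :
  (forall i, P (F i)) -> P (fun x => \sum_(i <- r | Q i) F i x).
Proof.
move=> PF; elim: r => [|i r IHr].
  by apply: (fun_transfer _ (funalg_cst 0)) => x; rewrite big_nil.
apply: fun_transfer => [x|]; first by rewrite big_cons.
by case: (Q i) => //; apply: funalgD.
Qed.

Lemma funalg_prod (I : Type) (r : seq I) (Q : pred I) (F : I -> T -> C) :
  (forall i, P (F i)) -> P (fun x => \prod_(i <- r | Q i) F i x).
Proof.
move=> PF; elim: r => [|i r IHr].
  by apply: (fun_transfer _ (funalg_cst 1)) => x; rewrite big_nil.
apply: fun_transfer => [x|]; first by rewrite big_cons.
by case: (Q i) => //; apply: funalgM.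
Qed.

Lemma funalgX f n : P f -> P (fun x => f x ^+ n).
Proof.
move=> Pf; elim: n => [|n IHn]; first exact: funalg_cst.
apply: fun_transfer => [x|]; first by rewrite exprS.
exact: funalgM.
Qed.

Lemma funalg_meval n (p : {mpoly C[n]}) (X : T -> 'I_n -> C) :
  (forall i, P (fun x => X x i)) -> P (fun x => p.@[X x]).
Proof.
move=> PX; apply: fun_transfer => [x|]; first by rewrite mevalE.
apply: funalg_sum => m; apply: funalgM; first exact: funalg_cst.
by apply: funalg_prod => i; apply: funalgX.
Qed.

Lemma funalg_det n (M : T -> 'M[C]_n) :
  (forall i j, P (fun x => M x i j)) -> P (fun x => \det (M x)).
Proof.
move=> PM; apply: funalg_sum => s; apply: funalgM; first exact: funalg_cst.
exact: funalg_prod.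
Qed.

Lemma funalg_bil (m : T -> consts) (u v : T -> 'cV[C]_3) :
  (forall i j k, P (fun x => m x i j k)) ->
  (forall i, P (fun x => u x i 0)) -> (forall i, P (fun x => v x i 0)) ->
  forall k, P (fun x => bil (m x) (u x) (v x) k 0).
Proof.
move=> Pm Pu Pv k; apply: fun_transfer => [x|]; first by rewrite mxE.
apply: funalg_sum => i; apply: funalg_sum => j.
by apply: funalgM => //; apply: funalgM.
Qed.

End FunAlg.

Definition polyfun (f : C -> C) := exists q : {poly C}, forall t, q.[t] = f t.
Definition mpolyfun (f : Pt -> C) :=
  exists p : {mpoly C[54]}, forall x, p.@[x] = f x.

(* Rational functions whose only poles are at the zeros of D. *)
Definition ratfun (D f : C -> C) :=
  exists N (q : {poly C}), forall t, D t != 0 -> q.[t] = f t * D t ^+ N.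

Lemma funalg_polyfun : funalg polyfun.
Proof.
split=> [c | f g [p pE] [q qE] | f g [p pE] [q qE]].
- by exists c%:P => t; rewrite hornerC.
- by exists (p + q) => t; rewrite hornerD pE qE.
- by exists (p * q) => t; rewrite hornerM pE qE.
Qed.

Lemma funalg_mpolyfun : funalg mpolyfun.
Proof.
split=> [c | f g [p pE] [q qE] | f g [p pE] [q qE]].
- by exists c%:MP => x; rewrite mevalC.
- by exists (p + q) => x; rewrite mevalD pE qE.
- by exists (p * q) => x; rewrite mevalM pE qE.
Qed.

Lemma polyfun_id : polyfun id.
Proof. by exists 'X => t; rewrite hornerX. Qed.

Lemma mpolyfun_coord i : mpolyfun (fun x => x i).
Proof. by exists 'X_i => x; rewrite mevalXU. Qed.

Lemma funalg_ratfun D : polyfun D -> funalg (ratfun D).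
Proof.
case=> d dE; split=> [c | f g [N [p pE]] [K [q qE]] | f g [N [p pE]] [K [q qE]]].
- by exists 0%N, c%:P => t _; rewrite hornerC mulr1.
- exists (N + K)%N, (p * d ^+ K + q * d ^+ N) => t Dt.
  by rewrite !hornerE !dE pE // qE // exprD; ring.
- exists (N + K)%N, (p * q) => t Dt.
  by rewrite hornerM pE // qE // exprD; ring.
Qed.

Lemma ratfun_poly D f : polyfun f -> ratfun D f.
Proof. by case=> q qE; exists 0%N, q => t _; rewrite qE mulr1. Qed.

Lemma ratfun_inv D : ratfun D (fun t => (D t)^-1).
Proof. by exists 1%N, 1 => t Dt; rewrite hornerC expr1 mulVf. Qed.

(** The naturals below [size q] stay distinct in characteristic zero, which is one root too many for
    a nonzero [q]. *)
Lemma poly_eq0_of_horner (q : {poly C}) : (forall t, q.[t] = 0) -> q = 0.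
Proof.
move=> q0; apply: contraTeq isT => nz_q.
pose s := [seq (n%:R : C) | n <- iota 0 (size q)].
have us : uniq s.
  rewrite map_inj_uniq ?iota_uniq // => i j.
  wlog lij : i j / (i <= j)%N.
    by move=> W; case: (leqP i j) => [|/ltnW] h e; [|symmetry]; apply: W.
  rewrite -(subnK lij) natrD; case: (j - i)%N => [|k] // /esym/eqP.
  by rewrite -subr_eq0 addrK (negbTE (natC_neq0 k)).
have rs : all (root q) s by apply/allP => t _; apply/rootP.
by have := max_poly_roots nz_q rs us; rewrite size_map size_iota ltnn.
Qed.

(** * Zariski closures, irreducibility and irreducible components *)

Lemma zclosure_sub A : subset A (zclosure A).
Proof. by move=> x Ax B _; apply. Qed.

Lemma zclosure_min A B : zclosed B -> subset A B -> subset (zclosure A) B.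
Proof. by move=> cB AB x; apply. Qed.

Lemma zclosureP A x :
  zclosure A x <-> forall p : {mpoly C[54]}, (forall y, A y -> p.@[y] = 0) -> p.@[x] = 0.
Proof.
split=> [cAx p pA | h B [S BS] AB].
  apply: (cAx (zero_locus (eq p))) => //; first by exists (eq p).
  by move=> y Ay _ <-; apply: pA.
by apply/BS => p Sp; apply: h => y /AB/BS; apply.
Qed.

Lemma zclosed_zclosure A : zclosed (zclosure A).
Proof.
exists (fun p => forall y, A y -> p.@[y] = 0) => x.
by split=> [/zclosureP h | h]; [|apply/zclosureP].
Qed.

Lemma zclosed_mpolyfun (I : Type) (f : I -> Pt -> C) :
  (forall i, mpolyfun (f i)) -> zclosed (fun x => forall i, f i x = 0).
Proof.
move=> Pf; exists (fun p => exists i, forall x, p.@[x] = f i x) => x.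
split=> [h p [i ->] // | h i].
by have [p pE] := Pf i; rewrite -pE; apply: h; exists i.
Qed.

Lemma zclosedI A B : zclosed A -> zclosed B -> zclosed (fun x => A x /\ B x).
Proof.
move=> [S AS] [T BT]; exists (fun p => S p \/ T p) => x; split.
  by move=> [/AS Sx /BT Tx] p [/Sx|/Tx].
by move=> h; split; [apply/AS|apply/BT] => p hp; apply: h; [left|right].
Qed.

(** A union is cut out by the products of one equation from each side. *)
Lemma zclosedU A B : zclosed A -> zclosed B -> zclosed (fun x => A x \/ B x).
Proof.
move=> [S AS] [T BT].
exists (fun r => exists p q, [/\ S p, T q & r = p * q]) => x; split.
  move=> h r [p [q [Sp Tq ->]]]; rewrite mevalM.
  by case: h => [/AS/(_ p Sp)|/BT/(_ q Tq)] ->; rewrite ?mul0r ?mulr0.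
move=> h; apply: NNPP => /not_or_and[nA nB]; apply: nB; apply/BT => q Tq.
apply: NNPP => /eqP nzq; apply: nA; apply/AS => p Sp.
have /eqP : (p * q).@[x] = 0 by apply: h; exists p, q.
by rewrite mevalM mulf_eq0 (negbTE nzq) orbF => /eqP.
Qed.

Lemma not_subset A B : ~ subset A B -> exists2 x, A x & ~ B x.
Proof.
move=> nAB; apply: NNPP => h; apply: nAB => x Ax.
by apply: NNPP => nBx; apply: h; exists x.
Qed.

Lemma not_zero_locus S x : ~ zero_locus S x -> exists2 p, S p & p.@[x] != 0.
Proof.
move=> n0; apply: NNPP => h; apply: n0 => p Sp.
by apply/eqP; apply: contraT => nz; case: h; exists p.
Qed.

Lemma irreducible_zclosure A : irreducible A -> irreducible (zclosure A).
Proof.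
move=> [[x Ax] irrA]; split; first by exists x; apply: zclosure_sub.
move=> F1 F2 cF1 cF2 sub.
have : subset A (fun x => F1 x \/ F2 x) by move=> y /zclosure_sub/sub.
by case/(irrA _ _ cF1 cF2) => h; [left|right]; apply: zclosure_min.
Qed.

(** If [p1] is nonzero at [a] and [p2] at [b], both restrict, after clearing poles, to nonzero
    polynomials on a curve through [a] and [b]; yet their product vanishes along the curve. *)
Lemma irreducible_of_curves A :
  (exists x, A x) ->
  (forall a b, A a -> A b -> exists (D : C -> C) (X : C -> Pt),
     [/\ polyfun D, D 0 != 0 /\ D 1 != 0, forall i, ratfun D (fun t => X t i),
         X 0 = a /\ X 1 = b & forall t, D t != 0 -> A (X t)]) ->
  irreducible A.
Proof.
move=> neA curves; split=> // F1 F2 [S1 E1] [S2 E2] sub.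
apply: NNPP => /not_or_and[/not_subset[a Aa nF1] /not_subset[b Ab nF2]].
have [p1 S1p1 nz1] : exists2 p, S1 p & p.@[a] != 0.
  by apply: not_zero_locus => /E1.
have [p2 S2p2 nz2] : exists2 p, S2 p & p.@[b] != 0.
  by apply: not_zero_locus => /E2.
have [D [X [PD [D0 D1] RX [X0 X1] AX]]] := curves _ _ Aa Ab.
have [N1 [q1 q1E]] := funalg_meval (funalg_ratfun PD) p1 RX.
have [N2 [q2 q2E]] := funalg_meval (funalg_ratfun PD) p2 RX.
have [d dE] := PD.
(* The factor [d] takes care of the zeros of [D], where nothing is known about [q1] and [q2]. *)
have /eqP : q1 * q2 * d = 0.
  apply: poly_eq0_of_horner => t; rewrite !hornerM dE.
  have [->|Dt] := eqVneq (D t) 0; first by rewrite mulr0.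
  rewrite q1E // q2E //; case: (sub _ (AX t Dt)).
    by move=> /E1/(_ _ S1p1) ->; rewrite !mul0r.
  by move=> /E2/(_ _ S2p2) ->; rewrite mul0r mulr0 mul0r.
rewrite !mulf_eq0 => /orP[/orP[]|] /eqP q0.
- have := q1E 0 D0; rewrite q0 horner0 X0 => /esym/eqP.
  by rewrite mulf_eq0 (negbTE nz1) (negbTE (expf_neq0 _ D0)).
- have := q2E 1 D1; rewrite q0 horner0 X1 => /esym/eqP.
  by rewrite mulf_eq0 (negbTE nz2) (negbTE (expf_neq0 _ D1)).
- by move: (dE 0); rewrite q0 horner0 => e; rewrite -e eqxx in D0.
Qed.

(** An equation of [A] restricted to the curve vanishes after multiplication by the nonzero
    polynomial [e], hence vanishes for all [t], also at the zeros of [e]. *)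
Lemma zclosure_curve A (X : C -> Pt) (e : C -> C) t0 :
  (forall i, polyfun (fun t => X t i)) -> polyfun e -> e t0 != 0 ->
  (forall t, e t != 0 -> A (X t)) -> forall t, zclosure A (X t).
Proof.
move=> PX [r rE] et0 AX t; apply/zclosureP => p pA.
have [q qE] := funalg_meval funalg_polyfun p PX.
have /eqP : q * r = 0.
  apply: poly_eq0_of_horner => s; rewrite hornerM rE.
  have [->|es] := eqVneq (e s) 0; first by rewrite mulr0.
  by rewrite qE pA ?mul0r //; apply: AX.
rewrite mulf_eq0 => /orP[] /eqP q0; first by rewrite -qE q0 horner0.
by move: et0; rewrite -rE q0 horner0 eqxx.
Qed.

Lemma irreducible_sub_union (s : seq (Pt -> Prop)) A :
  (forall Z, List.In Z s -> zclosed Z) -> irreducible A ->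
  subset A (fun x => exists2 Z, List.In Z s & Z x) ->
  exists2 Z, List.In Z s & subset A Z.
Proof.
move=> cs [[x Ax] irrA]; elim: s cs => [|Z s IHs] cs sub.
  by have [? []] := sub x Ax.
have cU : zclosed (fun y => exists2 Z', List.In Z' s & Z' y).
  elim: s {IHs sub} cs => [|Z' s IHs] cs.
    exists (fun p => p = 1) => y; split=> [[? []] | /(_ 1 erefl)/eqP].
    by rewrite meval1 oner_eq0.
  have -> : (fun y => exists2 Y, List.In Y (Z' :: s) & Y y) =
            (fun y => Z' y \/ exists2 Y, List.In Y s & Y y).
    apply: functional_extensionality => y.
    apply: propositional_extensionality; split.
      by case=> Y [<-|Ys] Yy; [left|right; exists Y].
    by case=> [Zy|[Y Ys Yy]]; [exists Z'|exists Y] => //=; [left|right].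
  apply: zclosedU; first by apply: cs; right; left.
  by apply: IHs => Y [<-|Ys]; apply: cs; [left|right; right].
have [|sZ|sU] := irrA Z _ (cs Z (or_introl erefl)) cU.
- by move=> y /sub[Y [<-|Ys] Yy]; [left|right; exists Y].
- by exists Z => //; left.
- have [||Y Ys sY] := IHs => // [Y Ys|]; first by apply: cs; right.
  by exists Y => //; right.
Qed.

(** An irreducible set between [Z] and [X] lies in some listed [Y]; then [Z] is contained in [Y],
    and incomparability forces [Y = Z]. *)
Lemma irr_components (X : Pt -> Prop) (s : seq (Pt -> Prop)) :
  (forall Z, List.In Z s -> [/\ zclosed Z, irreducible Z & subset Z X]) ->
  subset X (fun x => exists2 Z, List.In Z s & Z x) ->
  (forall Y Z, List.In Y s -> List.In Z s -> subset Y Z -> Y = Z) ->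
  forall A, irr_component X A <-> exists2 Z, List.In Z s & set_eq A Z.
Proof.
move=> hs cov incomp A.
have cs Z : List.In Z s -> zclosed Z by case/hs.
split=> [[AX irrA maxA] | [Z Zs AZ]].
  have [|Z Zs AZ] := irreducible_sub_union cs irrA; first by move=> x /AX/cov.
  have [_ irrZ ZX] := hs Z Zs; exists Z => // x.
  by split=> [/AZ//|]; have /(_ x)[] := maxA Z irrZ AZ ZX.
have [_ [[x Zx] irrZ] ZX] := hs Z Zs; split=> [y /AZ/ZX // | | B irrB AB BX].
  split=> [|F1 F2 cF1 cF2 sub]; first by exists x; apply/AZ.
  have [|h|h] := irrZ _ _ cF1 cF2; first by move=> y /AZ/sub.
  - by left=> y /AZ/h.
  - by right=> y /AZ/h.
have [|Y Ys BY] := irreducible_sub_union cs irrB; first by move=> y /BX/cov.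
have ZY : Z = Y by apply: incomp => // y /AZ/AB/BY.
by move=> y; split=> [/BY|/AB //]; rewrite -ZY => /AZ.
Qed.

(** * Three-dimensional algebras up to isomorphism *)

Local Notation V := 'cV[C]_3.
Local Notation i0 := (@Ordinal 3 0 isT).
Local Notation i1 := (@Ordinal 3 1 isT).
Local Notation i2 := (@Ordinal 3 2 isT).

Lemma forall_ord3 (P : 'I_3 -> Prop) : P i0 -> P i1 -> P i2 -> forall i, P i.
Proof.
move=> p0 p1 p2 [[|[|[|n]]] lt_n] //.
- by rewrite (_ : Ordinal lt_n = i0) //; apply: val_inj.
- by rewrite (_ : Ordinal lt_n = i1) //; apply: val_inj.
- by rewrite (_ : Ordinal lt_n = i2) //; apply: val_inj.
Qed.

Lemma sum3 (U : nmodType) (F : 'I_3 -> U) : \sum_i F i = F i0 + F i1 + F i2.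
Proof.
rewrite !big_ord_recr big_ord0 /= add0r.
by congr (F _ + F _ + F _); apply: val_inj.
Qed.

Definition vec3 (a b c : C) : V := \col_k nth 0 [:: a; b; c] k.

Lemma vecP (u v : V) : u i0 0 = v i0 0 -> u i1 0 = v i1 0 -> u i2 0 = v i2 0 -> u = v.
Proof. by move=> e0 e1 e2; apply/colP; apply: forall_ord3. Qed.

Lemma bilE m u v k : bil m u v k 0 = \sum_i \sum_j u i 0 * v j 0 * m i j k.
Proof. by rewrite mxE. Qed.

Opaque bil.

Lemma col_entryD (u v : V) k : (u + v) k 0 = u k 0 + v k 0. Proof. by rewrite mxE. Qed.
Lemma col_entryN (u : V) k : (- u) k 0 = - u k 0. Proof. by rewrite mxE. Qed.
Lemma col_entryZ a (u : V) k : (a *: u) k 0 = a * u k 0. Proof. by rewrite mxE. Qed.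
Lemma col_entry0 k : (0 : V) k 0 = 0. Proof. by rewrite mxE. Qed.
Lemma vec30 a b c : vec3 a b c i0 0 = a. Proof. by rewrite mxE. Qed.
Lemma vec31 a b c : vec3 a b c i1 0 = b. Proof. by rewrite mxE. Qed.
Lemma vec32 a b c : vec3 a b c i2 0 = c. Proof. by rewrite mxE. Qed.

Hint Rewrite col_entryD col_entryN col_entryZ col_entry0 vec30 vec31 vec32 : colE.
Ltac col_simp := autorewrite with colE.
Ltac lin_ring := apply/colP => ?; col_simp; ring.
Ltac vec_ring := apply: vecP; col_simp; ring.

Section Bil.
Variable m : consts.

Lemma bilDl u v w : bil m (u + v) w = bil m u w + bil m v w.
Proof. by apply/colP => k; rewrite ?(bilE, mxE, sum3); ring. Qed.

Lemma bilDr u v w : bil m w (u + v) = bil m w u + bil m w v.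
Proof. by apply/colP => k; rewrite ?(bilE, mxE, sum3); ring. Qed.

Lemma bilZl a u v : bil m (a *: u) v = a *: bil m u v.
Proof. by apply/colP => k; rewrite ?(bilE, mxE, sum3); ring. Qed.

Lemma bilZr a u v : bil m u (a *: v) = a *: bil m u v.
Proof. by apply/colP => k; rewrite ?(bilE, mxE, sum3); ring. Qed.

Lemma bilNl u v : bil m (- u) v = - bil m u v.
Proof. by rewrite -scaleN1r bilZl scaleN1r. Qed.

Lemma bilNr u v : bil m u (- v) = - bil m u v.
Proof. by rewrite -scaleN1r bilZr scaleN1r. Qed.

Lemma bil0l v : bil m 0 v = 0.
Proof. by have := bilZl 0 0 v; rewrite !scale0r. Qed.

Lemma bil0r v : bil m v 0 = 0.
Proof. by have := bilZr 0 v 0; rewrite !scale0r. Qed.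

Lemma bil_suml (F : 'I_3 -> V) v : bil m (\sum_i F i) v = \sum_i bil m (F i) v.
Proof. by rewrite !sum3 !bilDl. Qed.

Lemma bil_sumr (F : 'I_3 -> V) v : bil m v (\sum_i F i) = \sum_i bil m v (F i).
Proof. by rewrite !sum3 !bilDr. Qed.

Lemma bil_delta i j : bil m (delta_mx i 0) (delta_mx j 0) = \col_k m i j k.
Proof.
apply/colP => k; rewrite bilE !mxE (bigD1 i) //= (bigD1 j) //= !mxE !eqxx !mul1r.
rewrite big1 ?addr0 => [|l ne_l]; last by rewrite !mxE (negbTE ne_l) mulr0 mul0r.
rewrite big1 ?addr0 => // l ne_l.
by rewrite big1 // => l' _; rewrite !mxE (negbTE ne_l) !mul0r.
Qed.

End Bil.

Hint Rewrite bilDl bilDr bilZl bilZr bilNl bilNr bil0l bil0r : bilE.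
Ltac bil_simp := autorewrite with bilE.

Lemma col_sum_delta (u : V) : u = \sum_i u i 0 *: delta_mx i 0.
Proof.
rewrite {1}(matrix_sum_delta u); apply: eq_bigr => i _.
by rewrite big_ord1.
Qed.

Lemma bil_act g m u v :
  bil (act g m) u v = g *m bil m (invmx g *m u) (invmx g *m v).
Proof.
transitivity (\sum_i \sum_j (u i 0 * v j 0) *:
   (g *m bil m (invmx g *m delta_mx i 0) (invmx g *m delta_mx j 0))).
  apply/colP => k; rewrite bilE summxE; apply: eq_bigr => i _.
  by rewrite summxE; apply: eq_bigr => j _; rewrite [RHS]mxE.
rewrite [u in RHS]col_sum_delta [v in RHS]col_sum_delta !mulmx_sumr.
rewrite bil_suml mulmx_sumr; apply: eq_bigr => i _.
rewrite bil_sumr mulmx_sumr; apply: eq_bigr => j _.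
by rewrite -!scalemxAr bilZl bilZr scalerA -scalemxAr mulrC.
Qed.

Lemma consts_ext (m m' : consts) : (forall u v, bil m u v = bil m' u v) -> m = m'.
Proof.
move=> e; apply: functional_extensionality => i.
apply: functional_extensionality => j; apply: functional_extensionality => k.
have := congr1 (fun v : V => v k 0) (e (delta_mx i 0) (delta_mx j 0)).
by rewrite !bil_delta !mxE.
Qed.

(** The intertwining form of orbit membership, free of the inverse matrix that occurs in [act]; see
    [orbit_iso]. *)
Definition iso (m b m' b' : consts) : Prop :=
  exists2 g, g \in unitmx & forall u v,
    g *m bil m u v = bil m' (g *m u) (g *m v) /\
    g *m bil b u v = bil b' (g *m u) (g *m v).

Lemma orbit_iso m b x : orbit m b x <-> iso m b (pt_mul x) (pt_br x).
Proof.
split=> [[g [ug h]] | [g ug h]]; exists g => //.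
  have [-> ->] : pt_mul x = act g m /\ pt_br x = act g b.
    split; do 3![apply: functional_extensionality => ?];
      by [rewrite /pt_mul (h _ _ _).1 | rewrite /pt_br (h _ _ _).2].
  by move=> u v; rewrite !bil_act !mulKmx.
split=> // i j k; rewrite /act; split.
  have [-> _] := h (invmx g *m delta_mx i 0) (invmx g *m delta_mx j 0).
  by rewrite !mulKVmx // bil_delta mxE.
have [_ ->] := h (invmx g *m delta_mx i 0) (invmx g *m delta_mx j 0).
by rewrite !mulKVmx // bil_delta mxE.
Qed.

Lemma iso_act g m b : g \in unitmx -> iso m b (act g m) (act g b).
Proof. by move=> ug; exists g => // u v; rewrite !bil_act !mulKmx. Qed.

Lemma iso_refl m b : iso m b m b.
Proof. by exists 1%:M => [|u v]; rewrite ?unitmx1 // !mul1mx. Qed.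

Lemma iso_sym m b m' b' : iso m b m' b' -> iso m' b' m b.
Proof.
move=> [g ug h]; exists (invmx g) => [|u v]; first by rewrite unitmx_inv.
have [e1 e2] := h (invmx g *m u) (invmx g *m v).
by rewrite !mulKVmx // in e1 e2; rewrite -e1 -e2 !mulKmx.
Qed.

Lemma iso_trans m1 b1 m2 b2 m3 b3 :
  iso m1 b1 m2 b2 -> iso m2 b2 m3 b3 -> iso m1 b1 m3 b3.
Proof.
move=> [g ug hg] [h uh hh]; exists (h *m g) => [|u v].
  by rewrite unitmx_mul uh.
have [e1 e2] := hg u v; have [e3 e4] := hh (g *m u) (g *m v).
by rewrite -!mulmxA e1 e2.
Qed.

Lemma is_poisson_iso m b m' b' : iso m b m' b' -> is_poisson m b -> is_poisson m' b'.
Proof.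
move=> [g ug h] P x' y' z'.
rewrite -(mulKVmx ug x') -(mulKVmx ug y') -(mulKVmx ug z').
move: (invmx g *m x') (invmx g *m y') (invmx g *m z') => x y z.
have em u v : bil m' (g *m u) (g *m v) = g *m bil m u v by have [] := h u v.
have eb u v : bil b' (g *m u) (g *m v) = g *m bil b u v by have [] := h u v.
have [c a s j l] := P x y z; split.
- by rewrite (em x y) (em y x) c.
- by rewrite (em x y) (em y z) (em _ z) (em x) a.
- by rewrite (eb x x) s mulmx0.
- by rewrite (eb y z) (eb z x) (eb x y) (eb x) (eb y) (eb z) -!mulmxDr j mulmx0.
- by rewrite (em x y) (eb x z) (eb y z) (eb _ z) (em _ y) (em x) -mulmxDr l.
Qed.

(** * Explicit determinants, coordinates in a basis, and multiplication tables *)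

Definition det3 (u v w : V) : C :=
  u i0 0 * (v i1 0 * w i2 0 - v i2 0 * w i1 0)
  - v i0 0 * (u i1 0 * w i2 0 - u i2 0 * w i1 0)
  + w i0 0 * (u i1 0 * v i2 0 - u i2 0 * v i1 0).

Definition mx3 (u v w : V) : 'M[C]_3 := row_mx u (row_mx v w : 'M_(3, 1 + 1)).

Lemma mx3E u v w k :
  [/\ mx3 u v w k i0 = u k 0, mx3 u v w k i1 = v k 0 & mx3 u v w k i2 = w k 0].
Proof.
split.
- by rewrite -(row_mxEl u (row_mx v w : 'M_(3, 1 + 1)) k 0); congr (mx3 _ _ _ _ _); apply: val_inj.
- rewrite -(row_mxEl v w k 0) -(row_mxEr u (row_mx v w : 'M_(3, 1 + 1)) k).
  by congr (mx3 _ _ _ _ _); apply: val_inj.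
- rewrite -(row_mxEr v w k 0) -(row_mxEr u (row_mx v w : 'M_(3, 1 + 1)) k).
  by congr (mx3 _ _ _ _ _); apply: val_inj.
Qed.

Lemma det_mx22 (M : 'M[C]_2) : \det M = M 0 0 * M 1 1 - M 0 1 * M 1 0.
Proof.
rewrite (expand_det_row _ 0) !big_ord_recl big_ord0 /cofactor !det_mx11 !mxE.
rewrite addr0 /= expr0 expr1 mul1r mulN1r mulrN.
by congr (M _ _ * M _ _ - M _ _ * M _ _); apply: val_inj.
Qed.

Lemma det_mx33 (M : 'M[C]_3) :
  \det M = M i0 i0 * (M i1 i1 * M i2 i2 - M i2 i1 * M i1 i2)
         - M i0 i1 * (M i1 i0 * M i2 i2 - M i2 i0 * M i1 i2)
         + M i0 i2 * (M i1 i0 * M i2 i1 - M i2 i0 * M i1 i1).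
Proof.
rewrite (expand_det_row _ i0) sum3 /cofactor !det_mx22 !mxE.
have e01 : lift i0 (0 : 'I_2) = i1 by apply: val_inj.
have e02 : lift i0 (1 : 'I_2) = i2 by apply: val_inj.
have e10 : lift i1 (0 : 'I_2) = i0 by apply: val_inj.
have e12 : lift i1 (1 : 'I_2) = i2 by apply: val_inj.
have e20 : lift i2 (0 : 'I_2) = i0 by apply: val_inj.
have e21 : lift i2 (1 : 'I_2) = i1 by apply: val_inj.
by rewrite e01 e02 e10 e12 e20 e21 /=; ring.
Qed.

Lemma det_mx3 u v w : \det (mx3 u v w) = det3 u v w.
Proof.
rewrite det_mx33; have [-> -> ->] := mx3E u v w i0.
have [-> -> ->] := mx3E u v w i1; have [-> -> ->] := mx3E u v w i2.
by rewrite /det3; ring.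
Qed.

Lemma det3_mulmx g u v w : det3 (g *m u) (g *m v) (g *m w) = \det g * det3 u v w.
Proof.
rewrite -!det_mx3 -det_mulmx; congr (\det _); apply/matrixP => k.
have [e0 e1 e2] := mx3E (g *m u) (g *m v) (g *m w) k.
apply: forall_ord3; rewrite ?e0 ?e1 ?e2 !mxE; apply: eq_bigr => l _;
  by have [E0 E1 E2] := mx3E u v w l; rewrite ?E0 ?E1 ?E2.
Qed.

Definition comb (u v w x : V) : V := x i0 0 *: u + x i1 0 *: v + x i2 0 *: w.

Lemma mx3_mulmx u v w x : mx3 u v w *m x = comb u v w x.
Proof.
by apply/colP => k; rewrite !mxE sum3; have [-> -> ->] := mx3E u v w k; ring.
Qed.

(* Cramer's rule. *)
Lemma combP u v w (d := det3 u v w) x :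
  d != 0 -> x = (det3 x v w / d) *: u + (det3 u x w / d) *: v + (det3 u v x / d) *: w.
Proof. by rewrite /d /det3 => nz; apply: vecP; rewrite !mxE; field. Qed.

(** Replacing one column of the determinant by [x] multiplies it by the corresponding coefficient of
    [x]. *)
Lemma comb_inj u v w a b c a' b' c' : det3 u v w != 0 ->
  a *: u + b *: v + c *: w = a' *: u + b' *: v + c' *: w ->
  [/\ a = a', b = b' & c = c'].
Proof.
move=> nz e; pose x := a *: u + b *: v + c *: w.
have h k : x k 0 = a' * u k 0 + b' * v k 0 + c' * w k 0 by rewrite /x e !mxE.
have h' k : x k 0 = a * u k 0 + b * v k 0 + c * w k 0 by rewrite !mxE.
split; apply: (mulIf nz).
- transitivity (det3 x v w); rewrite /det3; first by rewrite !h'; ring.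
  by rewrite !h; ring.
- transitivity (det3 u x w); rewrite /det3; first by rewrite !h'; ring.
  by rewrite !h; ring.
- transitivity (det3 u v x); rewrite /det3; first by rewrite !h'; ring.
  by rewrite !h; ring.
Qed.

(* Structure constants of a (skew-)symmetric product, given by the products of
   the basis vectors. *)
Definition symt (v00 v01 v02 v11 v12 v22 : V) : consts := fun i j k =>
  (nth (nth 0 [::]) [:: nth 0 [:: v00; v01; v02]; nth 0 [:: v01; v11; v12];
       nth 0 [:: v02; v12; v22]] i j) k 0.
Definition skewt (v01 v02 v12 : V) : consts := fun i j k =>
  (nth (nth 0 [::]) [:: nth 0 [:: 0; v01; v02]; nth 0 [:: - v01; 0; v12];
       nth 0 [:: - v02; - v12; 0]] i j) k 0.

Lemma bil_symt v00 v01 v02 v11 v12 v22 u v :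
  bil (symt v00 v01 v02 v11 v12 v22) u v =
  (u i0 0 * v i0 0) *: v00 + (u i0 0 * v i1 0 + u i1 0 * v i0 0) *: v01
  + (u i0 0 * v i2 0 + u i2 0 * v i0 0) *: v02 + (u i1 0 * v i1 0) *: v11
  + (u i1 0 * v i2 0 + u i2 0 * v i1 0) *: v12 + (u i2 0 * v i2 0) *: v22.
Proof. by apply/colP => k; rewrite bilE !mxE !sum3 /symt /=; ring. Qed.

Lemma bil_skewt v01 v02 v12 u v :
  bil (skewt v01 v02 v12) u v =
  (u i0 0 * v i1 0 - u i1 0 * v i0 0) *: v01
  + (u i0 0 * v i2 0 - u i2 0 * v i0 0) *: v02
  + (u i1 0 * v i2 0 - u i2 0 * v i1 0) *: v12.
Proof. by apply/colP => k; rewrite bilE !mxE !sum3 /skewt /= !mxE; ring. Qed.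

(** The matrix with columns [u], [v], [w] intertwines the two structures; symmetry and alternation
    reduce the check to products of basis vectors in increasing order. *)
Lemma iso_table (m b : consts) (u v w : V) v00 v01 v02 v11 v12 v22 w01 w02 w12 :
  (forall x y, bil m x y = bil m y x) -> (forall x, bil b x x = 0) ->
  det3 u v w != 0 ->
  [/\ bil m u u = comb u v w v00, bil m u v = comb u v w v01,
      bil m u w = comb u v w v02, bil m v v = comb u v w v11
    & bil m v w = comb u v w v12 /\ bil m w w = comb u v w v22] ->
  [/\ bil b u v = comb u v w w01, bil b u w = comb u v w w02
    & bil b v w = comb u v w w12] ->
  iso (symt v00 v01 v02 v11 v12 v22) (skewt w01 w02 w12) m b.
Proof.
move=> mC bxx nz [e00 e01 e02 e11 [e12 e22]] [f01 f02 f12].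
have bN x y : bil b x y = - bil b y x.
  apply/eqP; rewrite -addr_eq0; apply/eqP; have := bxx (x + y).
  by rewrite !bilDl !bilDr !bxx add0r addr0.
exists (mx3 u v w) => [|x y]; first by rewrite unitmxE det_mx3 unitfE.
rewrite !mx3_mulmx bil_symt bil_skewt /comb.
rewrite !(bilDl, bilDr, bilZl, bilZr) !bxx (mC v u) (mC w u) (mC w v).
rewrite (bN v u) (bN w u) (bN w v) e00 e01 e02 e11 e12 e22 f01 f02 f12.
by split; rewrite /comb; lin_ring.
Qed.

(** Inverse of [idx]: base 3 digits give [i], [j], [k], and the comparison with 27 selects product
    or bracket. *)
Definition mkpt (m b : consts) : Pt := fun l =>
  (if (l < 27)%N then m else b)
    (inord (l %% 27 %/ 9)) (inord (l %% 9 %/ 3)) (inord (l %% 3)).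

Lemma val_idx c (i j k : 'I_3) : idx c i j k = (c * 27 + i * 9 + j * 3 + k)%N :> nat.
Proof.
by rewrite /idx inordK //; case: c; have := ltn_ord i; have := ltn_ord j; have := ltn_ord k; lia.
Qed.

Lemma pt_mulK m b : pt_mul (mkpt m b) = m.
Proof.
apply: functional_extensionality => i; apply: functional_extensionality => j.
apply: functional_extensionality => k; rewrite /pt_mul /mkpt val_idx.
have := ltn_ord i; have := ltn_ord j; have := ltn_ord k.
move=> lk lj li; rewrite ifT; last by lia.
by congr m; apply: val_inj; rewrite /= inordK; lia.
Qed.

Lemma pt_brK m b : pt_br (mkpt m b) = b.
Proof.
apply: functional_extensionality => i; apply: functional_extensionality => j.
apply: functional_extensionality => k; rewrite /pt_br /mkpt val_idx.
have := ltn_ord i; have := ltn_ord j; have := ltn_ord k.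
move=> lk lj li; have -> : (true * 27 + i * 9 + j * 3 + k < 27)%N = false by lia.
by congr b; apply: val_inj; rewrite /= inordK; lia.
Qed.

Lemma ptK x : mkpt (pt_mul x) (pt_br x) = x.
Proof.
apply: functional_extensionality => l; rewrite /mkpt /pt_mul /pt_br.
have := ltn_ord l; case: ifP => h lt_l; congr x; apply: val_inj;
  by rewrite /= val_idx !inordK; lia.
Qed.

Lemma iso_actP m b m' b' : iso m b m' b' ->
  exists2 g, g \in unitmx & m' = act g m /\ b' = act g b.
Proof.
move=> [g ug h]; exists g => //; split; apply: consts_ext => u v; rewrite bil_act.
  by rewrite (h _ _).1 !mulKVmx.
by rewrite (h _ _).2 !mulKVmx.
Qed.

(** * Families of orbits: irreducibility and a criterion for lying in the closure *)

Definition orbits (mu br : C -> consts) : Pt -> Prop :=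
  fun x => exists a, orbit (mu a) (br a) x.

Lemma orbits_mkpt mu br m b :
  orbits mu br (mkpt m b) <-> exists a, iso (mu a) (br a) m b.
Proof. by split=> -[a h]; exists a; move: h; rewrite orbit_iso pt_mulK pt_brK. Qed.

Definition polyconsts (m : C -> consts) := forall i j k, polyfun (fun t => m t i j k).

Section FunAlgMx.
Variables (T : Type) (P : (T -> C) -> Prop).
Hypothesis algP : funalg P.

Lemma funalg_mulmx m n p (M : T -> 'M[C]_(m, n)) (N : T -> 'M[C]_(n, p)) :
  (forall i j, P (fun x => M x i j)) -> (forall i j, P (fun x => N x i j)) ->
  forall i j, P (fun x => (M x *m N x) i j).
Proof.
move=> PM PN i j; apply: fun_transfer => [x|]; first by rewrite mxE.
by apply: (funalg_sum algP) => k; apply: (funalgM algP).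
Qed.

Lemma funalg_adj n (M : T -> 'M[C]_n) :
  (forall i j, P (fun x => M x i j)) -> forall i j, P (fun x => (\adj (M x)) i j).
Proof.
move=> PM i j; apply: fun_transfer => [x|]; first by rewrite mxE.
apply: (funalgM algP); first exact: (funalg_cst algP).
apply: (funalg_det algP) => k l; apply: fun_transfer => [x|]; first by rewrite !mxE.
exact: PM.
Qed.

Lemma funalg_mkpt (m b : T -> consts) :
  (forall i j k, P (fun x => m x i j k)) -> (forall i j k, P (fun x => b x i j k)) ->
  forall l, P (fun x => mkpt (m x) (b x) l).
Proof. by move=> Pm Pb l; rewrite /mkpt; case: (l < 27)%N. Qed.

(* The inverse of [g x] is passed separately: it need not lie in [P]. *)
Lemma funalg_act (g h : T -> 'M[C]_3) (m : T -> consts) :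
  (forall i j, P (fun x => g x i j)) -> (forall i j, P (fun x => h x i j)) ->
  (forall i j k, P (fun x => m x i j k)) -> forall i j k,
  P (fun x => (g x *m bil (m x) (h x *m delta_mx i 0) (h x *m delta_mx j 0)) k 0).
Proof.
move=> Pg Ph Pm i j k; apply: funalg_mulmx => // l l'; rewrite (ord1 l').
by apply: (funalg_bil algP) => // {}l; apply: funalg_mulmx => // *; apply: (funalg_cst algP).
Qed.

End FunAlgMx.

Lemma polyfun_comp f a : polyfun f -> polyfun a -> polyfun (f \o a).
Proof.
by move=> [p pE] [q qE]; exists (p \Po q) => t; rewrite horner_comp qE pE.
Qed.

Lemma polyfun_line (a b : C) : polyfun (fun t => a + t * (b - a)).
Proof.
apply: (funalgD funalg_polyfun); first exact: (funalg_cst funalg_polyfun).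
apply: (funalgM funalg_polyfun); [exact: polyfun_id|exact: (funalg_cst funalg_polyfun)].
Qed.

Lemma ratfun_eq D f g : (forall t, D t != 0 -> f t = g t) -> ratfun D g -> ratfun D f.
Proof. by move=> e [N [q qE]]; exists N, q => t Dt; rewrite e ?qE. Qed.

(** Off the zeros of [D] the inverse of [g t] is the adjugate divided by the determinant, so these
    zeros are the only possible poles. *)
Lemma ratfun_act D (g : C -> 'M[C]_3) (m : C -> consts) i j k :
  (forall t, D t = \det (g t)) -> (forall i j, polyfun (fun t => g t i j)) ->
  polyconsts m -> ratfun D (fun t => act (g t) (m t) i j k).
Proof.
move=> DE Pg Pm.
have PD : polyfun D.
  by apply: fun_transfer; [exact: DE|apply: (funalg_det funalg_polyfun)].
have Rg i' j' : ratfun D (fun t => g t i' j') by apply: ratfun_poly.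
pose h t := (D t)^-1 *: \adj (g t).
have Rh i' j' : ratfun D (fun t => h t i' j').
  apply: fun_transfer => [t|]; first by rewrite mxE.
  apply: (funalgM (funalg_ratfun PD)); first exact: ratfun_inv.
  exact: (funalg_adj (funalg_ratfun PD)).
have Rm i' j' k' : ratfun D (fun t => m t i' j' k') by apply: ratfun_poly.
apply: ratfun_eq (funalg_act (funalg_ratfun PD) Rg Rh Rm i j k) => t Dt.
by rewrite /act /invmx unitmxE -DE unitfE Dt /h DE.
Qed.

Lemma irreducible_orbits mu br :
  polyconsts mu -> polyconsts br -> irreducible (orbits mu br).
Proof.
move=> Pmu Pbr; apply: irreducible_of_curves.
  by exists (mkpt (mu 0) (br 0)); apply/orbits_mkpt; exists 0; apply: iso_refl.
move=> x y [a /orbit_iso/iso_actP[g ug [xm xb]]] [c /orbit_iso/iso_actP[h uh [ym yb]]].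
(* The line may leave the invertible matrices; the zeros of [\det (k t)] become the poles of the
   curve. *)
pose s t := a + t * (c - a); pose k t := g + t *: (h - g).
have Ps : polyfun s by apply: polyfun_line.
have Pk i j : polyfun (fun t => k t i j).
  by apply: (fun_transfer _ (polyfun_line (g i j) (h i j))) => t; rewrite !mxE.
have s0 : s 0 = a by rewrite /s mul0r addr0.
have s1 : s 1 = c by rewrite /s mul1r addrC subrK.
have k0 : k 0 = g by rewrite /k scale0r addr0.
have k1 : k 1 = h by rewrite /k scale1r addrC subrK.
exists (fun t => \det (k t)),
  (fun t => mkpt (act (k t) (mu (s t))) (act (k t) (br (s t)))); split.
- exact: (funalg_det funalg_polyfun).
- by rewrite k0 k1 -!unitfE -!unitmxE.
- have PD : polyfun (fun t => \det (k t)) by apply: (funalg_det funalg_polyfun).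
  apply: (funalg_mkpt (P := ratfun _)) => i j l; apply: ratfun_act => // ? ? ?.
    exact: (polyfun_comp (Pmu _ _ _) Ps).
  exact: (polyfun_comp (Pbr _ _ _) Ps).
- by rewrite k0 k1 s0 s1 -xm -xb -ym -yb !ptK.
- move=> t Dt; apply/orbits_mkpt; exists (s t); apply: iso_act.
  by rewrite unitmxE unitfE.
Qed.

(** The criterion behind every degeneration: [m t], [b t] is the deformation in some basis, [e]
    detects the members known to lie in the family, [t0] shows that [e] is not zero, and [x] is the
    member at [t1]. *)
Lemma zclosure_orbits mu br (m b : C -> consts) e t0 t1 x :
  polyconsts m -> polyconsts b -> polyfun e -> e t0 != 0 ->
  (forall t, e t != 0 -> exists a, iso (mu a) (br a) (m t) (b t)) ->
  iso (m t1) (b t1) (pt_mul x) (pt_br x) -> zclosure (orbits mu br) x.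
Proof.
move=> Pm Pb Pe et0 fam /iso_actP[g ug [xm xb]].
rewrite -(ptK x) xm xb.
(* One constant change of basis carries the member at [t1] to [x] and keeps every other member in
   its orbit. *)
apply: (@zclosure_curve _ (fun t => mkpt (act g (m t)) (act g (b t))) e t0) => //.
  apply: (funalg_mkpt (P := polyfun)) => i j k;
    apply: (funalg_act funalg_polyfun) => // *; exact: (funalg_cst funalg_polyfun).
move=> t /fam[a h]; apply/orbits_mkpt; exists a.
exact: iso_trans h (iso_act _ _ ug).
Qed.

(** * Degenerations *)

Lemma orbit_as_orbits m b : orbit m b = orbits (fun=> m) (fun=> b).
Proof.
apply: functional_extensionality => x; apply: propositional_extensionality.
by split=> [h | [_ h] //]; exists 0.
Qed.

Lemma symt_comm v00 v01 v02 v11 v12 v22 u v :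
  bil (symt v00 v01 v02 v11 v12 v22) u v = bil (symt v00 v01 v02 v11 v12 v22) v u.
Proof. by rewrite !bil_symt; lin_ring. Qed.

Lemma skewt_alt v01 v02 v12 u : bil (skewt v01 v02 v12) u u = 0.
Proof. by rewrite !bil_skewt; lin_ring. Qed.

Lemma funalg_symt (T : Type) (P : (T -> C) -> Prop) (v00 v01 v02 v11 v12 v22 : T -> V) :
  (forall k, [/\ P (fun t => v00 t k 0), P (fun t => v01 t k 0), P (fun t => v02 t k 0),
    P (fun t => v11 t k 0) & P (fun t => v12 t k 0) /\ P (fun t => v22 t k 0)]) ->
  forall i j k, P (fun t => symt (v00 t) (v01 t) (v02 t) (v11 t) (v12 t) (v22 t) i j k).
Proof.
by move=> h i j k; have [? ? ? ? [? ?]] := h k; move: i j;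
  do 2!apply: forall_ord3; rewrite /symt /=.
Qed.

Lemma funalg_skewt (T : Type) (P : (T -> C) -> Prop) (v01 v02 v12 : T -> V) :
  funalg P ->
  (forall k, [/\ P (fun t => v01 t k 0), P (fun t => v02 t k 0)& P (fun t => v12 t k 0)]) ->
  forall i j k, P (fun t => skewt (v01 t) (v02 t) (v12 t) i j k).
Proof.
move=> algP h i j k; have [? ? ?] := h k; have P0 := funalg_cst algP 0.
have PN (v : T -> V) : P (fun t => v t k 0) -> P (fun t => (- v t) k 0).
  by move/(funalgN algP); apply: fun_transfer => t; rewrite mxE.
have PZ : P (fun=> (0 : V) k 0) by apply: fun_transfer P0 => t; rewrite mxE.
by move: i j; do 2!apply: forall_ord3; rewrite /skewt /=; auto.
Qed.

Lemma funalg_vec3 (T : Type) (P : (T -> C) -> Prop) (a b c : T -> C) :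
  P a -> P b -> P c -> forall k, P (fun t => vec3 (a t) (b t) (c t) k 0).
Proof.
move=> Pa Pb Pc; apply: forall_ord3.
- by apply: fun_transfer Pa => t; rewrite vec30.
- by apply: fun_transfer Pb => t; rewrite vec31.
- by apply: fun_transfer Pc => t; rewrite vec32.
Qed.

Ltac polyfun_tac := repeat first
  [ exact: (funalg_cst funalg_polyfun) | exact: polyfun_id
  | assumption
  | apply: (funalgD funalg_polyfun) | apply: (funalgN funalg_polyfun)
  | apply: (funalgM funalg_polyfun) | apply: (funalgX funalg_polyfun)
  | apply: polyfun_line ].

Ltac polyconsts_tac := first [apply: funalg_symt | apply: (funalg_skewt funalg_polyfun)];
  move=> ?; do ?split; apply: funalg_vec3; polyfun_tac.

Ltac table_tac := rewrite ?bil_symt ?bil_skewt /comb; apply: vecP; col_simp.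

Ltac table_eq := do 3![apply: functional_extensionality; apply: forall_ord3];
  rewrite /mk_sym /mk_skew ?big_cons ?big_nil /symt /skewt /zero_c /=;
  col_simp; try ring.

Local Notation z3 := (vec3 0 0 0).

Lemma zero_symtE : zero_c = symt z3 z3 z3 z3 z3 z3. Proof. by table_eq. Qed.
Lemma zero_skewtE : zero_c = skewt z3 z3 z3. Proof. by table_eq. Qed.
Lemma P34_brE a : P34_br a = skewt (vec3 0 1 0) (vec3 0 0 a) z3.
Proof. by rewrite /P34_br; table_eq. Qed.
Lemma P35_brE : P35_br = skewt (vec3 0 0 1) (vec3 (-2) 0 0) (vec3 0 2 0).
Proof. by rewrite /P35_br; table_eq. Qed.
Lemma P37_mulE : P37_mul = symt (vec3 1 0 0) z3 z3 (vec3 0 1 0) z3 (vec3 0 0 1).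
Proof. by rewrite /P37_mul; table_eq. Qed.
Lemma P316_mulE a : P316_mul a = symt z3 (vec3 0 0 1) z3 z3 z3 z3.
Proof. by rewrite /P316_mul; table_eq. Qed.
Lemma P316_brE a : P316_br a = skewt (vec3 0 0 a) z3 z3.
Proof. by rewrite /P316_br; table_eq. Qed.
Lemma P318_mulE : P318_mul = symt (vec3 1 0 0) (vec3 0 1 0) (vec3 0 0 1) z3 z3 z3.
Proof. by rewrite /P318_mul; table_eq. Qed.
Lemma P318_brE : P318_br = skewt z3 z3 (vec3 0 1 0).
Proof. by rewrite /P318_br; table_eq. Qed.
Lemma P320_mulE : P320_mul = symt (vec3 1 0 0) z3 z3 z3 z3 z3.
Proof. by rewrite /P320_mul; table_eq. Qed.
Lemma P320_brE : P320_br = skewt z3 z3 (vec3 0 1 0).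
Proof. by rewrite /P320_br; table_eq. Qed.

Lemma ex_sqrt (a : C) : exists b, b ^+ 2 = a.
Proof.
have /closed_rootP[b] : size ('X^2 - a%:P : {poly C}) != 1%N.
  by rewrite size_XnsubC.
by rewrite /root !hornerE subr_eq0 => /eqP; exists b.
Qed.

Ltac iso_table_tac u v w := apply: (@iso_table _ _ u v w);
  [exact: symt_comm | exact: skewt_alt | | split; [| | | |split] | split].

(** The first basis vector acts on the other two by a matrix of trace [l + k] and determinant
    [l * k], hence with eigenvalues [l] and [k]. *)
Lemma P34_iso_eigen (p q l k : C) : q != 0 -> l != 0 -> l - k != 0 ->
  iso (P34_mul (k / l)) (P34_br (k / l)) (symt z3 z3 z3 z3 z3 z3)
    (skewt (vec3 0 p ((p * (l + k - p) - l * k) / q)) (vec3 0 q (l + k - p)) z3).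
Proof.
move=> nzq nzl nzlk; rewrite P34_brE /P34_mul zero_symtE.
(* The last two vectors are eigenvectors for [l] and [k], independent because [q] and [l - k] are
   nonzero; dividing the acting vector by [l] turns the eigenvalues into 1 and [k / l]. *)
iso_table_tac (vec3 l^-1 0 0) (vec3 0 q (l - p)) (vec3 0 q (k - p));
  [|by table_tac; field; rewrite ?nzq ?nzl ..].
rewrite (_ : det3 _ _ _ = - (l^-1 * q * (l - k))); last by rewrite /det3; col_simp; ring.
by rewrite oppr_eq0 !mulf_neq0 ?invr_eq0.
Qed.

(** The bracket is [D (y x z)] with [D] diagonal. A multiple of the first basis vector plays the
    role of the Cartan element, normalised to eigenvalues 2 and -2; the eigenvectors [(0, 1, k)] and
    [(0, 1, -k)] need [k ^+ 2 = - (d2 / d1)], and the second is scaled so that their bracket is that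
    element. *)
Lemma sl2_iso_diag (d0 d1 d2 : C) : d0 != 0 -> d1 != 0 -> d2 != 0 ->
  iso P35_mul P35_br (symt z3 z3 z3 z3 z3 z3)
    (skewt (vec3 0 0 d2) (vec3 0 (- d1) 0) (vec3 d0 0 0)).
Proof.
move=> nz0 nz1 nz2; rewrite /P35_mul zero_symtE P35_brE.
have [k kE] := ex_sqrt (- (d2 / d1)).
have nzk : k != 0.
  apply: contraNneq nz2 => k0; move/eqP: kE.
  by rewrite k0 expr0n eq_sym oppr_eq0 mulf_eq0 invr_eq0 (negbTE nz1) orbF.
have d2E : d2 = - (k ^+ 2 * d1) by rewrite kE; field.
have nz22 : (2 : C) != 0 by apply: natC_neq0.
rewrite d2E.
iso_table_tac (vec3 0 1 k) (vec3 0 (d0 * d1 * k ^+ 2)^-1 (- (d0 * d1 * k)^-1))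
   (vec3 (- (2 / (k * d1))) 0 0);
  [|by table_tac; field; rewrite ?nz0 ?nz1 ?nzk ..].
rewrite (_ : det3 _ _ _ = 4%:R / (d0 * d1 ^+ 2 * k ^+ 2)); last first.
  by rewrite /det3; col_simp; field; rewrite ?nz0 ?nz1 ?nzk.
by rewrite !mulf_neq0 ?invr_eq0 ?mulf_neq0 ?expf_neq0 ?natC_neq0.
Qed.

(** A base change [g] turns the matrix [M] of the bracket [M (y x z)] into [g M g^T / det g]. For
    [g] lower unitriangular and [M] diagonal this is the product [L D L^T]. *)
Lemma diag_iso_sym (d0 d1 d2 l1 l2 l3 : C) :
  iso (symt z3 z3 z3 z3 z3 z3) (skewt (vec3 0 0 d2) (vec3 0 (- d1) 0) (vec3 d0 0 0))
    (symt z3 z3 z3 z3 z3 z3)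
    (let b := d0 * l1 in let c := d0 * l2 in let d := d0 * l1 ^+ 2 + d1 in
     let e := d0 * l1 * l2 + d1 * l3 in let f := d0 * l2 ^+ 2 + d1 * l3 ^+ 2 + d2 in
     skewt (vec3 c e f) (vec3 (- b) (- d) (- e)) (vec3 d0 b c)).
Proof.
iso_table_tac (vec3 1 l1 l2) (vec3 0 1 l3) (vec3 0 0 1); [|by table_tac; ring ..].
by rewrite (_ : det3 _ _ _ = 1) ?oner_eq0 // /det3; col_simp; ring.
Qed.

(** Factors [T^3 - c T^2 - b T - a]: one root [r] by algebraic closedness, then the quadratic
    formula for the two roots with sum [s] and product [P]. *)
Lemma cubic_roots (a b c : C) : exists r1 r2 r3,
  [/\ a = r1 * r2 * r3, b = - (r1 * r2 + r1 * r3 + r2 * r3) & c = r1 + r2 + r3].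
Proof.
have [r] := @solve_monicpoly C 3 (nth 0 [:: a; b; c]) isT.
rewrite !big_ord_recr big_ord0 /= add0r expr0 mulr1 expr1 => rE.
pose s := c - r; pose P := - b - r * s; have [d dE] := ex_sqrt (s ^+ 2 - 4%:R * P).
have nz2 : (2 : C) != 0 by apply: natC_neq0.
have PE : P = (s + d) / 2 * ((s - d) / 2).
  transitivity ((s ^+ 2 - d ^+ 2) / 4%:R); last by field.
  by rewrite dE; field.
have rs : c = r + s by rewrite /s; ring.
exists r, ((s + d) / 2), ((s - d) / 2); split; last by rewrite rs; field.
  rewrite -mulrA -PE /P; apply/eqP; rewrite -subr_eq0; apply/eqP.
  by transitivity (- (r ^+ 3 - (a + b * r + c * r ^+ 2))); [rewrite rs; ring|rewrite rE subrr oppr0].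
transitivity (- (r * s + P)); first by rewrite /P; ring.
by rewrite PE; field.
Qed.

(** The table of the basis [T, T^2, T^3] of [T C[T] / (T p(T))], where [p] has roots [r1], [r2],
    [r3], so that [T^4 = a T + b T^2 + c T^3]. The entries [d] and the last one are [T^5] and
    [T^6]. *)
Definition cyclic_mul (r1 r2 r3 : C) : consts :=
  let c := r1 + r2 + r3 in let b := - (r1 * r2 + r1 * r3 + r2 * r3) in
  let a := r1 * r2 * r3 in
  let d := vec3 (c * a) (a + c * b) (b + c ^+ 2) in
  symt (vec3 0 1 0) (vec3 0 0 1) (vec3 a b c) (vec3 a b c) d
    (vec3 (b * a + c ^+ 2 * a) (c * a + b ^+ 2 + c ^+ 2 * b)
       (a + b * c + c * (b + c ^+ 2))).

(** Evaluation at the three roots sends [T] to [(r1, r2, r3)] with componentwise product; the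
    determinant is a Vandermonde one times the product of the roots. *)
Lemma cyclic_iso_P37 r1 r2 r3 :
  r1 * r2 * r3 * (r1 - r2) * (r1 - r3) * (r2 - r3) != 0 ->
  iso (cyclic_mul r1 r2 r3) (skewt z3 z3 z3) P37_mul P37_br.
Proof.
move=> nzr; rewrite P37_mulE /P37_br zero_skewtE.
iso_table_tac (vec3 r1 r2 r3) (vec3 (r1 ^+ 2) (r2 ^+ 2) (r3 ^+ 2))
  (vec3 (r1 ^+ 3) (r2 ^+ 3) (r3 ^+ 3)); [|by table_tac; ring ..].
rewrite (_ : det3 _ _ _ = - (r1 * r2 * r3 * (r1 - r2) * (r1 - r3) * (r2 - r3))) ?oppr_eq0 //.
by rewrite /det3; col_simp; ring.
Qed.

Section Degenerations.
Variable x : Pt.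
Let m := pt_mul x.
Let b := pt_br x.
Hypothesis Px : P3 x.

Let mC u v : bil m u v = bil m v u.
Proof. by have [] := Px u v 0. Qed.
Let b_alt u : bil b u u = 0.
Proof. by have [] := Px u 0 0. Qed.

Variables u v w : V.
Hypothesis nz : det3 u v w != 0.

(** The bracket of [v] and [w] is moved until its [v]-coefficient [e t] is nonzero. Then
    [e t *: v + q *: w] and [w] divided by [e t] replace [v] and [w] and satisfy the relation of the
    representative. *)
Lemma comp3_of_table p q :
  [/\ bil m u u = u, bil m u v = v, bil m u w = w, bil m v v = 0
    & bil m v w = 0 /\ bil m w w = 0] ->
  [/\ bil b u v = 0, bil b u w = 0 & bil b v w = p *: v + q *: w] -> comp3 x.
Proof.
move=> [e1 e2 e3 e4 [e5 e6]] [f1 f2 f3].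
rewrite /comp3 orbit_as_orbits.
pose e t := p + t * (1 - p).
apply: (@zclosure_orbits _ _ (fun=> symt (vec3 1 0 0) (vec3 0 1 0) (vec3 0 0 1) z3 z3 z3)
   (fun t => skewt z3 z3 (vec3 0 (e t) q)) e 1 0).
- by polyconsts_tac.
- by polyconsts_tac.
- exact: polyfun_line.
- by rewrite /e mul1r addrC subrK oner_eq0.
- move=> t et; exists 0; rewrite P318_mulE P318_brE.
  iso_table_tac (vec3 1 0 0) (vec3 0 (e t) q) (vec3 0 0 (e t)^-1);
    [by rewrite (_ : det3 _ _ _ = 1) ?oner_eq0 // /det3; col_simp; field
    |by table_tac; field ..].
apply: (iso_table mC b_alt nz); rewrite ?e1 ?e2 ?e3 ?e4 ?e5 ?e6 ?f1 ?f2 ?f3.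
  by split; [| | | |split]; rewrite /comb; lin_ring.
by split; rewrite /comb /e; lin_ring.
Qed.

Lemma comp4_of_table p q :
  [/\ bil m u u = u, bil m u v = 0, bil m u w = 0, bil m v v = 0
    & bil m v w = 0 /\ bil m w w = 0] ->
  [/\ bil b u v = 0, bil b u w = 0 & bil b v w = p *: v + q *: w] -> comp4 x.
Proof.
move=> [e1 e2 e3 e4 [e5 e6]] [f1 f2 f3].
rewrite /comp4 orbit_as_orbits.
pose e t := p + t * (1 - p).
apply: (@zclosure_orbits _ _ (fun=> symt (vec3 1 0 0) z3 z3 z3 z3 z3)
   (fun t => skewt z3 z3 (vec3 0 (e t) q)) e 1 0).
- by polyconsts_tac.
- by polyconsts_tac.
- exact: polyfun_line.
- by rewrite /e mul1r addrC subrK oner_eq0.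
- move=> t et; exists 0; rewrite P320_mulE P320_brE.
  iso_table_tac (vec3 1 0 0) (vec3 0 (e t) q) (vec3 0 0 (e t)^-1);
    [by rewrite (_ : det3 _ _ _ = 1) ?oner_eq0 // /det3; col_simp; field
    |by table_tac; field ..].
apply: (iso_table mC b_alt nz); rewrite ?e1 ?e2 ?e3 ?e4 ?e5 ?e6 ?f1 ?f2 ?f3.
  by split; [| | | |split]; rewrite /comb; lin_ring.
by split; rewrite /comb /e; lin_ring.
Qed.

(* In the deformation with [u w = t w] and [w w = t^2 w], [w / t^2] is idempotent. *)
Lemma comp4_of_square k : k != 0 ->
  [/\ bil m u u = w, bil m u v = 0, bil m u w = 0, bil m v v = 0
    & bil m v w = 0 /\ bil m w w = 0] ->
  [/\ bil b u v = k *: v, bil b u w = 0 & bil b v w = 0] -> comp4 x.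
Proof.
move=> nzk [e1 e2 e3 e4 [e5 e6]] [f1 f2 f3].
rewrite /comp4 orbit_as_orbits.
apply: (@zclosure_orbits _ _
   (fun t => symt (vec3 0 0 1) z3 (vec3 0 0 t) z3 z3 (vec3 0 0 (t * t)))
   (fun=> skewt (vec3 0 k 0) z3 z3) id 1 0).
- by polyconsts_tac.
- by polyconsts_tac.
- exact: polyfun_id.
- exact: oner_neq0.
- move=> t nzt; exists 0; rewrite P320_mulE P320_brE.
  (* The third vector is the combination of [u] and [w] that the idempotent annihilates, that has
     square zero, and whose bracket with [v] gives back [v]. *)
  iso_table_tac (vec3 0 0 (t * t)^-1) (vec3 0 1 0) (vec3 (- k^-1) 0 (t * k)^-1);
    [by rewrite (_ : det3 _ _ _ = (t * t * k)^-1) ?invr_eq0 ?mulf_neq0 //;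
     rewrite /det3; col_simp; field; rewrite nzk
    |by table_tac; field; rewrite ?nzt ?nzk ..].
apply: (iso_table mC b_alt nz); rewrite ?e1 ?e2 ?e3 ?e4 ?e5 ?e6 ?f1 ?f2 ?f3.
  by split; [| | | |split]; rewrite /comb; lin_ring.
by split; rewrite /comb; lin_ring.
Qed.

(** The product is a diagonal quadratic form on [u], [v] with values in the line of [w]. Once [e t]
    is nonzero the form is nondegenerate and has a basis of isotropic vectors. *)
Lemma comp6_of_table g k :
  [/\ bil m u u = w, bil m u v = 0, bil m u w = 0, bil m v v = g *: w
    & bil m v w = 0 /\ bil m w w = 0] ->
  [/\ bil b u v = k *: w, bil b u w = 0 & bil b v w = 0] -> comp6 x.
Proof.
move=> [e1 e2 e3 e4 [e5 e6]] [f1 f2 f3].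
pose e t := g + t * (1 - g).
apply: (@zclosure_orbits _ _
   (fun t => symt (vec3 0 0 1) z3 z3 (vec3 0 0 (e t)) z3 z3)
   (fun=> skewt (vec3 0 0 k) z3 z3) e 1 0).
- by polyconsts_tac.
- by polyconsts_tac.
- exact: polyfun_line.
- by rewrite /e mul1r addrC subrK oner_eq0.
- move=> t et; have [d dE] := ex_sqrt (- (e t)^-1); exists (- d * k).
  have nzd : d != 0.
    apply: contraNneq et => d0; move/eqP: dE.
    by rewrite d0 expr0n eq_sym oppr_eq0 invr_eq0.
  have {}dE : e t = - (d ^+ 2)^-1 by rewrite dE invrN invrK opprK.
  rewrite P316_mulE P316_brE dE.
  (* [u + d v] and [u - d v] are isotropic since [d ^+ 2 * e t = -1]; their product is [2 w] and
     their bracket [-2 d k w], whence the parameter [- d * k]. *)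
  iso_table_tac (vec3 1 d 0) (vec3 1 (- d) 0) (vec3 0 0 2);
    [by rewrite (_ : det3 _ _ _ = - (4%:R * d)) ?oppr_eq0 ?mulf_neq0 ?natC_neq0 //;
     rewrite /det3; col_simp; ring
    |by table_tac; field ..].
apply: (iso_table mC b_alt nz); rewrite ?e1 ?e2 ?e3 ?e4 ?e5 ?e6 ?f1 ?f2 ?f3.
  by split; [| | | |split]; rewrite /comb /e; lin_ring.
by split; rewrite /comb; lin_ring.
Qed.

Lemma comp5_of_table p q r s :
  (forall y z, bil m y z = 0) ->
  [/\ bil b u v = p *: v + r *: w, bil b u w = q *: v + s *: w & bil b v w = 0] ->
  comp5 x.
Proof.
move=> m0 [f1 f2 f3].
(* The action of [u] on [<v, w>] is deformed to one with nonzero distinct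
   eigenvalues and nonzero (0, 1) entry. *)
pose pt t := p + t * (0 - p); pose qt t := q + t * (1 - q).
pose rt t := r + t * (1 - r); pose st t := s + t * (0 - s).
pose disc t := (pt t - st t) ^+ 2 + 4%:R * (qt t * rt t).
pose det t := pt t * st t - qt t * rt t.
pose e t := qt t * disc t * det t.
apply: (@zclosure_orbits _ _ (fun=> symt z3 z3 z3 z3 z3 z3)
   (fun t => skewt (vec3 0 (pt t) (rt t)) (vec3 0 (qt t) (st t)) z3) e 1 0).
- by polyconsts_tac.
- by polyconsts_tac.
- by rewrite /e /disc /det; polyfun_tac.
(* At [t = 1] the action exchanges [v] and [w]: [qt] is 1, the discriminant is 4 and the determinant
   is -1. *)
- rewrite (_ : e 1 = - 4%:R) ?oppr_eq0 ?natC_neq0 //.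
  by rewrite /e /disc /det /pt /qt /rt /st; ring.
- move=> t; rewrite /e /disc /det.
  move: (pt t) (qt t) (rt t) (st t) => p1 q1 r1 s1.
  rewrite !mulf_eq0 !negb_or -andbA => /and3P[nzq nzD nzd].
  have [d dE] := ex_sqrt ((p1 - s1) ^+ 2 + 4%:R * (q1 * r1)).
  have nz2 : (2 : C) != 0 by apply: natC_neq0.
  have nz_d : d != 0 by apply: contraNneq nzD => d0; rewrite -dE d0 expr0n.
  pose l := (p1 + s1 + d) / 2; pose k := (p1 + s1 - d) / 2.
  have sE : s1 = l + k - p1 by rewrite /l /k; field.
  have rE : r1 = (p1 * s1 - l * k) / q1.
    have -> : l * k = p1 * s1 - q1 * r1.
      rewrite /l /k; transitivity (((p1 + s1) ^+ 2 - d ^+ 2) / 4%:R); last by rewrite dE; field.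
      by field.
    by field.
  have lk : l - k != 0 by rewrite (_ : l - k = d) // /l /k; field.
  have nzl : l != 0.
    apply: contraNneq nzd => l0; rewrite rE sE l0; apply/eqP; field.
    by [].
  exists (k / l); rewrite rE sE; exact: P34_iso_eigen.
apply: (iso_table mC b_alt nz); rewrite ?m0 ?f1 ?f2 ?f3.
  by split; [| | | |split]; rewrite /comb; lin_ring.
by split; rewrite /comb /pt /qt /rt /st; lin_ring.
Qed.

(** In the basis [u], [v], [w] the bracket is [M (y x z)] with [M] symmetric of rows [(a0, b0, c0)],
    [(b0, d0, e0)], [(c0, e0, f0)], moved linearly to the identity. The polynomial [e] is the
    product of the three leading principal minors, so no pivoting is required where it is
    nonzero. *)
Lemma comp1_of_table a0 b0 c0 d0 e0 f0 :
  (forall y z, bil m y z = 0) ->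
  [/\ bil b u v = c0 *: u + e0 *: v + f0 *: w,
      bil b u w = - (b0 *: u + d0 *: v + e0 *: w)
    & bil b v w = a0 *: u + b0 *: v + c0 *: w] ->
  comp1 x.
Proof.
move=> m0 [f1 f2 f3].
pose at' t := a0 + t * (1 - a0); pose bt t := b0 + t * (0 - b0).
pose ct t := c0 + t * (0 - c0); pose dt t := d0 + t * (1 - d0).
pose et t := e0 + t * (0 - e0); pose ft t := f0 + t * (1 - f0).
pose m2 t := at' t * dt t - bt t ^+ 2.
pose m3 t := at' t * dt t * ft t + (bt t * ct t * et t) * 2
  - at' t * et t ^+ 2 - dt t * ct t ^+ 2 - ft t * bt t ^+ 2.
pose e t := at' t * m2 t * m3 t.
rewrite /comp1 orbit_as_orbits.
apply: (@zclosure_orbits _ _ (fun=> symt z3 z3 z3 z3 z3 z3)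
   (fun t => skewt (vec3 (ct t) (et t) (ft t)) (vec3 (- bt t) (- dt t) (- et t))
      (vec3 (at' t) (bt t) (ct t))) e 1 0).
- by polyconsts_tac.
- by polyconsts_tac.
- by rewrite /e /m2 /m3; polyfun_tac.
- rewrite (_ : e 1 = 1) ?oner_eq0 //.
  by rewrite /e /m2 /m3 /at' /bt /ct /dt /et /ft; ring.
- move=> t; rewrite /e /m2 /m3.
  move: (at' t) (bt t) (ct t) (dt t) (et t) (ft t) => a B c d E f.
  rewrite !mulf_eq0 !negb_or -andbA => /and3P[nza nzm2 nzm3]; exists 0.
  (* LDL^T factorisation *)
  pose l1 := B / a; pose l2 := c / a; pose d1 := (a * d - B ^+ 2) / a.
  pose l3 := (a * E - B * c) / (a * d - B ^+ 2).
  pose d2 := f - a * l2 ^+ 2 - d1 * l3 ^+ 2.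
  have nzd1 : d1 != 0 by rewrite mulf_neq0 ?invr_eq0.
  have nzd2 : d2 != 0.
    apply: contraNneq nzm3 => d20; apply/eqP.
    transitivity ((a * d - B ^+ 2) * d2); last by rewrite d20 mulr0.
    by rewrite /d2 /l2 /d1 /l3; field; rewrite nza nzm2.
  apply: iso_trans (sl2_iso_diag nza nzd1 nzd2) _.
  have := diag_iso_sym a d1 d2 l1 l2 l3.
  have -> : a * l1 = B by rewrite /l1; field.
  have -> : a * l2 = c by rewrite /l2; field.
  have -> : a * l1 ^+ 2 + d1 = d by rewrite /l1 /d1; field.
  have -> : B * l2 + d1 * l3 = E.
    by rewrite /l2 /d1 /l3; field; rewrite nza nzm2.
  have -> // : a * l2 ^+ 2 + d1 * l3 ^+ 2 + d2 = f by rewrite /d2; ring.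
apply: (iso_table mC b_alt nz); rewrite ?m0 ?f1 ?f2 ?f3.
  by split; [| | | |split]; rewrite /comb; lin_ring.
by split; rewrite /comb /at' /bt /ct /dt /et /ft; lin_ring.
Qed.

(** By associativity all products follow from the expansion of [u w]; factoring this cubic relation
    gives the table of [cyclic_mul], whose roots are then moved. *)
Lemma comp2_of_cyclic :
  bil m u u = v -> bil m u v = w -> (forall y z, bil b y z = 0) -> comp2 x.
Proof.
move=> e1 e2 b0.
have mA y z t : bil m (bil m y z) t = bil m y (bil m z t) by have [] := Px y z t.
have [r1 [r2 [r3 [aE bE cE]]]] := cubic_roots (det3 (bil m u w) v w / det3 u v w)
  (det3 u (bil m u w) w / det3 u v w) (det3 u v (bil m u w) / det3 u v w).
have := combP (bil m u w) nz; rewrite {}aE {}bE {}cE => e3.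
have e4 : bil m v v = bil m u w by rewrite -{1}e1 mA e2.
have e5 : bil m v w = bil m u (bil m u w) by rewrite -{1}e1 mA.
have e6 : bil m w w = bil m u (bil m u (bil m u w)) by rewrite -{1}e2 mA e5.
(* The roots reach 1, 2, 3 at [t = 1], where [e] is [6 * (-1) * (-2) * (-1) = -12]. *)
pose s1 t := r1 + t * (1 - r1); pose s2 t := r2 + t * (2 - r2).
pose s3 t := r3 + t * (3%:R - r3).
pose e t := s1 t * s2 t * s3 t * (s1 t - s2 t) * (s1 t - s3 t) * (s2 t - s3 t).
rewrite /comp2 orbit_as_orbits.
apply: (@zclosure_orbits _ _ (fun t => cyclic_mul (s1 t) (s2 t) (s3 t))
   (fun=> skewt z3 z3 z3) e 1 0).
- by polyconsts_tac.
- by polyconsts_tac.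
- by rewrite /e; polyfun_tac.
- rewrite (_ : e 1 = - 12%:R) ?oppr_eq0 ?natC_neq0 //.
  by rewrite /e /s1 /s2 /s3; ring.
- by move=> t et; exists 0; apply: iso_sym; apply: cyclic_iso_P37.
have [s10 s20 s30] : [/\ s1 0 = r1, s2 0 = r2 & s3 0 = r3].
  by rewrite /s1 /s2 /s3; split; ring.
cbv beta; rewrite s10 s20 s30 /cyclic_mul; cbv zeta.
apply: (iso_table mC b_alt nz); rewrite ?e1 ?e2 ?e4 ?e5 ?e6 ?b0.
  rewrite !e3; bil_simp; rewrite e1 e2 !e3; bil_simp; rewrite e1 e2 !e3.
  by split; [| | | |split]; rewrite /comb; lin_ring.
by split; rewrite /comb; lin_ring.
Qed.

End Degenerations.

(** * Classification *)

(** Replaces continuity at 0: the polynomial times ['X] vanishes everywhere. *)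
Lemma polyfun_limit0 f : polyfun f -> (forall s, s != 0 -> f s = 0) -> f 0 = 0.
Proof.
move=> [q qE] f0; have /eqP : q * 'X = 0.
  apply: poly_eq0_of_horner => s; rewrite hornerM hornerX qE.
  by have [->|/f0 ->] := eqVneq s 0; rewrite ?mulr0 ?mul0r.
rewrite mulf_eq0 polyX_eq0 orbF => /eqP q0.
by rewrite -qE q0 horner0.
Qed.

Lemma vec_neq0 (u : V) : u != 0 -> [\/ u i0 0 != 0, u i1 0 != 0 | u i2 0 != 0].
Proof.
move=> nzu; apply: NNPP => h; case/eqP: nzu; apply: vecP; rewrite col_entry0;
  apply/eqP; apply: contraT => nz; case: h; [apply: Or31|apply: Or32|apply: Or33];
  exact: nz.
Qed.

Lemma ex_basis (u : V) : u != 0 -> exists v w, det3 u v w != 0.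
Proof.
case/vec_neq0 => nz.
- exists (vec3 0 1 0), (vec3 0 0 1); rewrite (_ : det3 _ _ _ = u i0 0) //.
  by rewrite /det3; col_simp; ring.
- exists (vec3 0 0 1), (vec3 1 0 0); rewrite (_ : det3 _ _ _ = u i1 0) //.
  by rewrite /det3; col_simp; ring.
- exists (vec3 1 0 0), (vec3 0 1 0); rewrite (_ : det3 _ _ _ = u i2 0) //.
  by rewrite /det3; col_simp; ring.
Qed.

(** Taking the three basis vectors for [w] shows that the cross product of [u] and [v] is zero. *)
Lemma det3_eq0_colinear (u v : V) :
  u != 0 -> (forall w, det3 u v w = 0) -> exists a, v = a *: u.
Proof.
move=> nzu h.
have e2 : u i0 0 * v i1 0 = u i1 0 * v i0 0.
  apply/eqP; rewrite -subr_eq0 -(h (vec3 0 0 1)) /det3; col_simp; apply/eqP; ring.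
have e1 : u i0 0 * v i2 0 = u i2 0 * v i0 0.
  apply/esym/eqP; rewrite -subr_eq0 -(h (vec3 0 1 0)) /det3; col_simp; apply/eqP; ring.
have e0 : u i1 0 * v i2 0 = u i2 0 * v i1 0.
  apply/eqP; rewrite -subr_eq0 -(h (vec3 1 0 0)) /det3; col_simp; apply/eqP; ring.
case: (vec_neq0 nzu) => nz.
- exists (v i0 0 / u i0 0); apply: vecP; col_simp; apply: (mulfI nz);
    rewrite ?e2 ?e1; by field.
- exists (v i1 0 / u i1 0); apply: vecP; col_simp; apply: (mulfI nz);
    rewrite -?e2 ?e0; by field.
- exists (v i2 0 / u i2 0); apply: vecP; col_simp; apply: (mulfI nz);
    rewrite -?e1 -?e0; by field.
Qed.

Lemma indep_or_colinear (u v : V) : u != 0 ->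
  (exists w, det3 u v w != 0) \/ exists a, v = a *: u.
Proof.
move=> nzu; have [|h] := classic (exists w, det3 u v w != 0); first by left.
right; apply: det3_eq0_colinear => // w; apply/eqP; apply: contraT => nz.
by case: h; exists w.
Qed.

Section Classification.
Variable x : Pt.
Let m := pt_mul x.
Let b := pt_br x.
Hypothesis Px : P3 x.

Let mC u v : bil m u v = bil m v u.
Proof. by have [] := Px u v 0. Qed.
Let mA u v w : bil m (bil m u v) w = bil m u (bil m v w).
Proof. by have [] := Px u v w. Qed.
Let mCA u v w : bil m u (bil m v w) = bil m v (bil m u w).
Proof. by rewrite -!mA (mC u). Qed.
Let b_alt u : bil b u u = 0.
Proof. by have [] := Px u 0 0. Qed.
Let leib u v w : bil b (bil m u v) w = bil m (bil b u w) v + bil m u (bil b v w).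
Proof. by have [] := Px u v w. Qed.
Let jacobi u v w :
  bil b u (bil b v w) + bil b v (bil b w u) + bil b w (bil b u v) = 0.
Proof. by have [] := Px u v w. Qed.

Let bN u v : bil b u v = - bil b v u.
Proof.
apply/eqP; rewrite -addr_eq0; apply/eqP; have := b_alt (u + v).
by rewrite !bilDl !bilDr !b_alt add0r addr0.
Qed.

Let double_eq0 (u : V) : u + u = 0 -> u = 0.
Proof.
rewrite -mulr2n -scaler_nat => /eqP; rewrite scaler_eq0.
by rewrite (negbTE (natC_neq0 1)) => /eqP.
Qed.

(** By the Leibniz rule the powers of [u] have zero bracket with each other, and here they form a
    basis. *)
Lemma comp2_of_det3 u : det3 u (bil m u u) (bil m u (bil m u u)) != 0 -> comp2 x.
Proof.
move=> nz; apply: (comp2_of_cyclic Px nz) => // y z; rewrite -/b.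
set v := bil m u u in nz *; set w := bil m u v in nz *.
have vu : bil b v u = 0 by rewrite leib b_alt bil0l bil0r addr0.
have wu : bil b w u = 0 by rewrite leib b_alt vu bil0l bil0r addr0.
have vw : bil b v w = 0 by rewrite leib (bN u w) wu oppr0 bil0l bil0r addr0.
have uv : bil b u v = 0 by rewrite bN vu oppr0.
have uw : bil b u w = 0 by rewrite bN wu oppr0.
have wv : bil b w v = 0 by rewrite bN vw oppr0.
rewrite (combP y nz) (combP z nz); bil_simp.
by rewrite !b_alt uv vu uw wu vw wv !scaler0 !addr0.
Qed.

(** * Algebras where [y], [y^2], [y^3] are always dependent: the case of an idempotent *)

Section NonCyclic.
Hypothesis noncyclic : forall y, det3 y (bil m y y) (bil m y (bil m y y)) = 0.

(** Either [y^2 = a y], and [y / a] is idempotent, or [y], [y^2] are independent and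
    [y^3 = a y + c y^2]. If [a = 0] in the latter case, [y^2 / c^2] is idempotent. *)
Lemma ex_idempotent y : bil m y (bil m y y) != 0 -> exists2 u, u != 0 & bil m u u = u.
Proof.
move=> nz3.
have nzy : y != 0 by apply: contraNneq nz3 => ->; rewrite bil0l.
have nz2 : bil m y y != 0 by apply: contraNneq nz3 => ->; rewrite bil0r.
have [[z nz] | [a ya]] := indep_or_colinear (bil m y y) nzy.
  have := combP (bil m y (bil m y y)) nz; rewrite noncyclic mul0r scale0r addr0.
  move: (_ / _) (_ / _) => c a e.
  have [a0|nza] := eqVneq a 0.
    rewrite a0 scale0r add0r in e.
    have nzc : c != 0 by apply: contraNneq nz3 => c0; rewrite e c0 scale0r.
    exists ((c ^+ 2)^-1 *: bil m y y).
      by rewrite scaler_eq0 negb_or nz2 invr_eq0 expf_neq0.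
    bil_simp; rewrite mA e bilZr e !scalerA; congr (_ *: _).
    by field.
  (* The relation reads [(y^2 - c y) y = a y], so [u] acts as a unit on [y], hence on itself. *)
  pose u := a^-1 *: (bil m y y - c *: y).
  have uy : bil m u y = y.
    rewrite /u; bil_simp; rewrite mA e.
    by rewrite addrK scalerA mulVf ?scale1r.
  exists u; first by apply: contraNneq nzy => u0; rewrite -uy u0 bil0l.
  rewrite {2}/u; bil_simp; rewrite -mA uy.
  by [].
have nza : a != 0.
  by apply: contraNneq nz2 => a0; rewrite ya a0 scale0r.
exists (a^-1 *: y); first by rewrite scaler_eq0 negb_or invr_eq0 nza.
by bil_simp; rewrite ya !scalerA; congr (_ *: _); field.
Qed.

Section Idempotent.
Variable u : V.
Hypotheses (nzu : u != 0) (uu : bil m u u = u).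

Let muK z : bil m u (bil m u z) = bil m u z.
Proof. by rewrite -mA uu. Qed.

(** Leibniz applied to [u u = u] gives [d = 2 u d] for [d = bil b u z]; multiplying by [u] yields
    [u d = 2 u d], so [u d = 0] and [d = 0]. *)
Lemma idempotent_central z : bil b u z = 0.
Proof.
have e : bil b u z = bil m u (bil b u z) + bil m u (bil b u z).
  by rewrite -{1}uu leib [in X in X + _ = _]mC.
have e0 : bil m u (bil b u z) = 0.
  have := congr1 (bil m u) e; rewrite bilDr !muK => /esym/eqP.
  by rewrite -subr_eq0 addrK => /eqP.
by rewrite e e0 addr0.
Qed.

Lemma polyfun_det3 (f g h : C -> V) :
  (forall k, polyfun (fun s => f s k 0)) -> (forall k, polyfun (fun s => g s k 0)) ->
  (forall k, polyfun (fun s => h s k 0)) -> polyfun (fun s => det3 (f s) (g s) (h s)).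
Proof. by move=> Pf Pg Ph; rewrite /det3; polyfun_tac. Qed.

Lemma polyfun_quadr (v0 v1 v2 : V) k :
  polyfun (fun s => (v0 + s *: v1 + s ^+ 2 *: v2) k 0).
Proof.
apply: fun_transfer => [s|]; first by rewrite !mxE.
by polyfun_tac.
Qed.

(* The coefficient of [s^2] in [det3 y y^2 y^3] at [y = u + s (w + v)]. *)
Lemma peirce_det3 w v : bil m u w = w -> bil m u v = 0 -> det3 u w v = 0.
Proof.
move=> uw uv.
have wv : bil m w v = 0 by rewrite -uw mA mCA uv bil0r.
set w2 := bil m w w; set v2 := bil m v v; set w3 := bil m w w2; set v3 := bil m v v2.
have wv2 : bil m w v2 = 0 by rewrite -mA wv bil0l.
have vw2 : bil m v w2 = 0 by rewrite mCA (mC v) wv bil0r.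
have uv2 : bil m u v2 = 0 by rewrite -mA uv bil0l.
have uw2 : bil m u w2 = w2 by rewrite -mA uw.
(* The columns are [y], [(y^2 - y) / s] and [(y^3 - 2 y^2 + y) / s], so [s ^+ 2 * f s] is the
   vanishing determinant; at [s = 0] they become [u], [w - v], [v]. *)
pose f s := det3 (u + s *: (w + v) + s ^+ 2 *: 0) (w - v + s *: (w2 + v2) + s ^+ 2 *: 0)
  (v + s *: (w2 - v2 *+ 2) + s ^+ 2 *: (w3 + v3)).
have Pf : polyfun f by apply: polyfun_det3 => k; apply: polyfun_quadr.
have f0 s : s != 0 -> f s = 0.
  move=> nzs; apply: (mulfI (expf_neq0 2 nzs)); rewrite mulr0.
  rewrite -[RHS](noncyclic (u + s *: (w + v))).
  bil_simp; rewrite !(mC v w, mC v u, mC w u) !(uu, uw, uv, wv) -/w2 -/v2.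
  bil_simp; rewrite !(mC v w, mC v u, mC w u) !(uu, uw, uv, wv) -/w2 -/v2.
  rewrite !(uv2, uw2, wv2, vw2) -/w3 -/v3.
  rewrite /f /det3 mulr2n; col_simp; ring.
have := polyfun_limit0 Pf f0; rewrite /f => {}f0; rewrite -{}f0.
by rewrite /det3 mulr2n; col_simp; ring.
Qed.

Lemma annihilated_det3 v : bil m u v = 0 -> det3 u v (bil m v v) = 0.
Proof.
move=> uv; set v2 := bil m v v; set v3 := bil m v v2.
have uv2 : bil m u v2 = 0 by rewrite -mA uv bil0l.
(* With [y = u + s v] the columns are [y], [(y^2 - y) / s] and [(y^3 - y^2) / s^2]. *)
pose f s := det3 (u + s *: v + s ^+ 2 *: 0) (- v + s *: v2 + s ^+ 2 *: 0)
  (- v2 + s *: v3 + s ^+ 2 *: 0).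
have Pf : polyfun f by apply: polyfun_det3 => k; apply: polyfun_quadr.
have f0 s : s != 0 -> f s = 0.
  move=> nzs; apply: (mulfI (expf_neq0 3 nzs)); rewrite mulr0.
  rewrite -[RHS](noncyclic (u + s *: v)).
  bil_simp; rewrite !(mC v u) !(uu, uv) -/v2; bil_simp; rewrite !(mC v u) !(uu, uv) -/v2.
  rewrite uv2 -/v3 /f /det3; col_simp; ring.
have := polyfun_limit0 Pf f0; rewrite /f => {}f0; rewrite -{}f0.
by rewrite /det3; col_simp; ring.
Qed.

Lemma unit_det3 v : bil m u v = v -> det3 u v (bil m v v) = 0.
Proof.
move=> uv; set v2 := bil m v v; set v3 := bil m v v2.
have uv2 : bil m u v2 = v2 by rewrite -mA uv.
(* With [y = u + s v] the columns are [y], [(y^2 - y) / s] and [(y^3 - 2 y^2 + y) / s^2]. *)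
pose f s := det3 (u + s *: v + s ^+ 2 *: 0) (v + s *: v2 + s ^+ 2 *: 0)
  (v2 + s *: v3 + s ^+ 2 *: 0).
have Pf : polyfun f by apply: polyfun_det3 => k; apply: polyfun_quadr.
have f0 s : s != 0 -> f s = 0.
  move=> nzs; apply: (mulfI (expf_neq0 3 nzs)); rewrite mulr0.
  rewrite -[RHS](noncyclic (u + s *: v)).
  bil_simp; rewrite !(mC v u) !(uu, uv) -/v2; bil_simp; rewrite !(mC v u) !(uu, uv) -/v2.
  rewrite uv2 -/v3 /f /det3; col_simp; ring.
have := polyfun_limit0 Pf f0; rewrite /f => {}f0; rewrite -{}f0.
by rewrite /det3; col_simp; ring.
Qed.

(** The square lies in the span of [u] and [v] by [annihilated_det3], and has no [u]-component
    because [u] annihilates it. *)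
Lemma annihilated_square v w : bil m u v = 0 -> bil m u w = 0 -> det3 u v w != 0 ->
  exists a, bil m v v = a *: v.
Proof.
move=> uv uw nz; have e := combP (bil m v v) nz.
rewrite annihilated_det3 // mul0r scale0r addr0 in e.
move: (_ / _) (_ / _) e => c a e; have := congr1 (bil m u) e.
rewrite bilDr !bilZr uu uv scaler0 addr0 -mA uv bil0l => /esym/eqP.
rewrite scaler_eq0 (negbTE nzu) orbF => /eqP a0.
by exists c; rewrite e a0 scale0r add0r.
Qed.

(** Every square taken in the annihilator of [u] is a multiple of its vector. This leads to
    [v w = (c v + a w) / 2]; comparing [w]-coordinates in [v (v w) = (v v) w] gives [a = 0], and
    likewise [c = 0]. *)
Lemma annihilator_null v w :
  bil m u v = 0 -> bil m u w = 0 -> det3 u v w != 0 ->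
  [/\ bil m v v = 0, bil m v w = 0 & bil m w w = 0].
Proof.
move=> uv uw nz; have nz2 : (2 : C) != 0 by apply: natC_neq0.
have uD k : bil m u (v + k *: w) = 0 by bil_simp; rewrite uv uw scaler0 addr0.
have nzD k : det3 u (v + k *: w) w != 0.
  by rewrite (_ : det3 _ _ _ = det3 u v w) // /det3; col_simp; ring.
have nzC : det3 u w v != 0.
  by rewrite (_ : det3 _ _ _ = - det3 u v w) ?oppr_eq0 // /det3; ring.
have [a va] := annihilated_square uv uw nz.
have [c wc] := annihilated_square uw uv nzC.
(* Two test vectors: [v + w] expresses [p] through [d], and the two coordinates at [v + 2 w]
   eliminate [e] and leave [d = a + c]. *)
have [d] := annihilated_square (uD 1) uw (nzD 1).
have [e] := annihilated_square (uD 2) uw (nzD 2).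
bil_simp; rewrite (mC w v) va wc; set p := bil m v w => he hd.
have pE : p = ((d - a) / 2) *: v + ((d - c) / 2) *: w.
  have {hd} : 2 *: p = (d - a) *: v + (d - c) *: w.
    apply/colP => k; have := congr1 (fun y : V => y k 0) hd; col_simp => h.
    apply/eqP; rewrite -subr_eq0; apply/eqP; move/eqP: h; rewrite -subr_eq0 => /eqP <-; by ring.
  move/(congr1 (fun y => 2^-1 *: y)); rewrite scalerA mulVf // scale1r => ->.
  by rewrite scalerDr !scalerA; congr (_ *: _ + _ *: _); ring.
have [_ h1 h2] : [/\ (0 : C) = 0, 2 * d - a = e & 2 * d + 2 * c = 2 * e].
  apply: (comb_inj nz); rewrite !scale0r !add0r.
  apply/colP => k; have := congr1 (fun y : V => y k 0) he; rewrite pE; col_simp => h.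
  apply/eqP; rewrite -subr_eq0; apply/eqP; move/eqP: h; rewrite -subr_eq0 => /eqP <-; by field.
have dE : d = a + c.
  apply: (mulfI nz2); transitivity (2 * d + ((2 * d + 2 * c) - 2 * e)).
    by rewrite h2 subrr addr0.
  by rewrite -h1; ring.
have {}pE : p = (c / 2) *: v + (a / 2) *: w.
  by rewrite pE dE; congr (_ *: _ + _ *: _); ring.
have sq0 (k : C) : k * k / 2 = (k / 2) * (k / 2) -> k = 0.
  move=> h; have /eqP : k * k = 0.
    transitivity (4%:R * (k * k / 2 - k / 2 * (k / 2))); first by field.
    by rewrite h subrr mulr0.
  by rewrite mulf_eq0 orbb => /eqP.
have a0 : a = 0.
  have vp : bil m v p = a *: p by rewrite /p -mA va bilZl.
  have [//|_ _] := @comb_inj u v w 0 (a * (c / 2)) (a * (a / 2)) 0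
     (c / 2 * a + a / 2 * (c / 2)) (a / 2 * (a / 2)) nz.
    have e1 : (c / 2) *: (a *: v) + (a / 2) *: p = a *: p.
      by rewrite -vp [in RHS]pE bilDr !bilZr va.
    by transitivity (a *: p); [|rewrite -e1]; rewrite pE; lin_ring.
  by rewrite mulrA; apply: sq0.
have c0 : c = 0.
  have wp : bil m w p = c *: p by rewrite /p mCA wc bilZr.
  have [//|_ h _] := @comb_inj u v w 0 (c * (c / 2)) (c * (a / 2)) 0
     (c / 2 * (c / 2)) (c / 2 * (a / 2) + a / 2 * c) nz.
    have e1 : (c / 2) *: p + (a / 2) *: (c *: w) = c *: p.
      by rewrite -wp [in RHS]pE bilDr !bilZr wc (mC w v).
    by transitivity (c *: p); [|rewrite -e1]; rewrite pE; lin_ring.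
  by apply: sq0; rewrite -h mulrA.
by rewrite pE a0 c0 !mul0r !scale0r addr0.
Qed.

(** By [peirce_det3] each [u w] lies in the span of [u] and [v0], hence is a multiple of [u].
    Subtracting multiples of [u] moves two basis vectors into the annihilator of [u], where products
    vanish; Leibniz keeps their bracket there. *)
Lemma comp4_of_annihilator v0 : v0 != 0 -> bil m u v0 = 0 -> comp4 x.
Proof.
move=> nzv0 uv0.
have umul w : exists a, bil m u w = a *: u.
  have [[z nz] | [a e]] := indep_or_colinear v0 nzu; last first.
    have := congr1 (bil m u) e; rewrite uv0 bilZr uu => /esym/eqP.
    by rewrite scaler_eq0 (negbTE nzu) orbF => /eqP a0; rewrite e a0 scale0r eqxx in nzv0.
  have e := combP (bil m u w) nz.
  have d0 : det3 u v0 (bil m u w) = 0.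
    apply/eqP; rewrite -oppr_eq0 -(peirce_det3 (muK w) uv0) /det3; apply/eqP; ring.
  rewrite d0 mul0r scale0r addr0 in e.
  move: (_ / _) (_ / _) e => c a e; exists a.
  by rewrite -muK e bilDr !bilZr uu uv0 scaler0 addr0.
have [w [v [uw uv nz]]] :
    exists w v, [/\ bil m u w = 0, bil m u v = 0 & det3 u w v != 0].
  have [w [v nz]] := ex_basis nzu; have [a ea] := umul w; have [c ec] := umul v.
  exists (w - a *: u), (v - c *: u); split.
  - by rewrite bilDr bilNr bilZr uu ea subrr.
  - by rewrite bilDr bilNr bilZr uu ec subrr.
  - by rewrite (_ : det3 _ _ _ = det3 u w v) // /det3; col_simp; ring.
have [ww wv vv] := annihilator_null uw uv nz.
have := combP (bil b w v) nz; move: (_ / _) (_ / _) (_ / _) => k3 k2 k1 e.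
have k10 : k1 = 0.
  have := leib u v w; rewrite uv idempotent_central !bil0l add0r (bN v w) bilNr.
  rewrite e !bilDr !bilZr uu uw uv !scaler0 !addr0 => /esym/eqP.
  by rewrite oppr_eq0 scaler_eq0 (negbTE nzu) orbF => /eqP.
rewrite k10 scale0r add0r in e.
apply: (comp4_of_table Px nz _ (And3 _ _ e)); first by split.
  exact: idempotent_central.
exact: idempotent_central.
Qed.

(** Completing the square makes [v v] and [w w] multiples of the unit; comparing [v + w] with
    [v + 2 w] makes [v w] one as well, and associativity kills the three multiples. Leibniz on
    [v v = 0] removes the [u]-component of the bracket. *)
Lemma comp3_of_unit : (forall v, bil m u v = v) -> comp3 x.
Proof.
move=> uE; have nz2 : (2 : C) != 0 by apply: natC_neq0.
have sq v w : det3 u v w != 0 -> exists a c, bil m v v = a *: u + c *: v.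
  move=> nz; have := combP (bil m v v) nz.
  rewrite unit_det3 // mul0r scale0r addr0 => e; by do 2!eexists; exact: e.
have [v [w [r [s [nz vv ww]]]]] : exists v w r s,
    [/\ det3 u v w != 0, bil m v v = r *: u & bil m w w = s *: u].
  have [v [w nz]] := ex_basis nzu.
  have nzC : det3 u w v != 0.
    by rewrite (_ : det3 _ _ _ = - det3 u v w) ?oppr_eq0 // /det3; ring.
  have [r [k vv]] := sq _ _ nz; have [s [l ww]] := sq _ _ nzC.
  exists (v - (k / 2) *: u), (w - (l / 2) *: u),
    (r + k ^+ 2 / 4%:R), (s + l ^+ 2 / 4%:R); split.
  - by rewrite (_ : det3 _ _ _ = det3 u v w) // /det3; col_simp; ring.
  - bil_simp; rewrite !(mC _ u) !uE vv.
    by apply/colP => i; col_simp; field.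
  - bil_simp; rewrite !(mC _ u) !uE ww.
    by apply/colP => i; col_simp; field.
have nzD k : det3 u (v + k *: w) w != 0.
  by rewrite (_ : det3 _ _ _ = det3 u v w) // /det3; col_simp; ring.
have [t [g]] := sq _ _ (nzD 1); have [t' [h]] := sq _ _ (nzD 2).
bil_simp; rewrite (mC w v) vv ww; set p := bil m v w => e2 e1.
have pE : p = ((t - r - s) / 2) *: u + (g / 2) *: (v + w).
  have {e1} : 2 *: p = (t - r - s) *: u + g *: (v + w).
    apply/colP => i; have := congr1 (fun y : V => y i 0) e1; col_simp => h1.
    apply/eqP; rewrite -subr_eq0; apply/eqP; move/eqP: h1; rewrite -subr_eq0 => /eqP <-; by ring.
  move/(congr1 (fun y => 2^-1 *: y)); rewrite scalerA mulVf // scale1r => ->.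
  by rewrite scalerDr !scalerA; congr (_ *: _ + _ *: _); ring.
have [_ h1 h2] : [/\ r + 4%:R * s + 2 * (t - r - s) = t', 2 * g = h & 2 * g = 2 * h].
  apply: (comb_inj nz).
  apply/colP => i; have := congr1 (fun y : V => y i 0) e2; rewrite pE; col_simp => h3.
  apply/eqP; rewrite -subr_eq0; apply/eqP; move/eqP: h3; rewrite -subr_eq0 => /eqP <-; by field.
have g0 : g = 0.
  apply: (mulfI nz2); transitivity (2 * h - 2 * g); last by rewrite h2 subrr mulr0.
  by rewrite -h1; ring.
rewrite g0 mul0r scale0r addr0 in pE; move: (_ / 2) pE => q pE.
have [_ q0 r0] : [/\ (0 : C) = 0, q = 0 & 0 = r].
  apply: (comb_inj nz).
  have : bil m v p = r *: w by rewrite /p -mA vv bilZl uE.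
  by rewrite pE bilZr (mC v u) uE => ->; lin_ring.
have [_ _ s0] : [/\ (0 : C) = 0, (0 : C) = 0 & 0 = s].
  have e3 : q *: w = s *: v.
    transitivity (bil m v (bil m w w)); last by rewrite ww bilZr (mC v) uE.
    by rewrite -mA -/p pE bilZl uE.
  have [|_ sE _] := @comb_inj u v w 0 0 q 0 s 0 nz; last by split.
  by rewrite e3; lin_ring.
rewrite -{}r0 scale0r in vv; rewrite -{}s0 scale0r in ww.
have vw : bil m v w = 0 by rewrite -/p pE q0 scale0r.
have := combP (bil b v w) nz; move: (_ / _) (_ / _) (_ / _) => k3 k2 k1 e.
have k10 : k1 = 0.
  have := leib v v w; rewrite vv bil0l (mC (bil b v w)) => /esym/double_eq0.
  rewrite e !bilDr !bilZr vv vw (mC v u) uE !scaler0 !addr0 => /eqP.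
  rewrite scaler_eq0 => /orP[/eqP //|/eqP v0]; move: nz.
  by rewrite v0 /det3; col_simp; rewrite !(mul0r, mulr0, subr0, addr0) eqxx.
rewrite k10 scale0r add0r in e.
apply: (comp3_of_table Px nz _ (And3 _ _ e)); first by split.
  exact: idempotent_central.
exact: idempotent_central.
Qed.

End Idempotent.

(** If [u] is not a unit, some [v - u v] is nonzero, and [u] annihilates it. *)
Lemma cover_idempotent u : u != 0 -> bil m u u = u -> comp3 x \/ comp4 x.
Proof.
move=> nzu uu; have [unit|h] := classic (forall v, bil m u v = v).
  by left; apply: comp3_of_unit unit.
have [v ne_v] : exists v, bil m u v <> v.
  by apply: NNPP => h'; apply: h => v; apply: NNPP => ne; apply: h'; exists v.
right; apply: (comp4_of_annihilator nzu uu (v0 := v - bil m u v)).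
  by rewrite subr_eq0 eq_sym; apply/eqP.
by rewrite bilDr bilNr -mA uu subrr.
Qed.

End NonCyclic.

(** * Nilpotent products *)

Section Nil.
Hypothesis nil3 : forall y, bil m y (bil m y y) = 0.

(** Polarisation of [y^3 = 0]: comparing [z] with [-z] isolates [y y z = 0], and polarising in [y]
    gives [2 y z t = 0]. *)
Lemma nil_mul3 y z t : bil m y (bil m z t) = 0.
Proof.
have yyz y' z' : bil m y' (bil m y' z') = 0.
  have e y1 z1 : 3%:R *: bil m y1 (bil m y1 z1) + 3%:R *: bil m z1 (bil m z1 y1) = 0.
    rewrite -(nil3 (y1 + z1)); bil_simp.
    rewrite !nil3 (mC z1 y1) (mCA z1 y1 y1) (mC z1 y1) (mCA y1 z1 z1) (mC y1 z1).
    by lin_ring.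
  have := e y' (- z'); have := e y' z'; bil_simp.
  set A := bil m y' _; set B := bil m z' _ => e1 e2.
  have : 6%:R *: A = 0.
    rewrite -[RHS](subrr 0) -{1}e1 -e2; lin_ring.
  by move/eqP; rewrite scaler_eq0 (negbTE (natC_neq0 5)) => /eqP.
apply: double_eq0; rewrite -[RHS](yyz (y + z) t); bil_simp.
by rewrite !yyz add0r addr0 (mCA z y t).
Qed.

(** Triple products vanish, so [w] annihilates everything and is independent of [u]; a third vector
    [v] can be corrected to have [u v = 0] and [v v = g w]. Leibniz then gives the bracket of [u]
    and [v] the form [k v + l w] with [k g = 0], and the two outcomes correspond to [k] nonzero or
    zero. *)
Lemma comp46_of_square u : bil m u u != 0 -> comp4 x \/ comp6 x.
Proof.
set w := bil m u u => nzw.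
have nzu : u != 0 by apply: contraNneq nzw => u0; rewrite /w u0 bil0l.
have wl z : bil m w z = 0 by rewrite /w mA nil_mul3.
have wr z : bil m z w = 0 by rewrite mC wl.
have [v nz] : exists v, det3 u v w != 0.
  have [[v nz] | [a e]] := indep_or_colinear w nzu.
    exists v; rewrite (_ : det3 _ _ _ = - det3 u w v) ?oppr_eq0 //.
    by rewrite /det3; ring.
  have := wr u; rewrite e bilZr -/w => /eqP; rewrite scaler_eq0 (negbTE nzw) orbF.
  by move=> /eqP a0; rewrite e a0 scale0r eqxx in nzw.
have sq0 (k : C) : k * k = 0 -> k = 0 by move/eqP; rewrite mulf_eq0 orbb => /eqP.
have sc0 (k : C) (z : V) : z != 0 -> k *: z = 0 -> k = 0.
  by move=> nzz /eqP; rewrite scaler_eq0 (negbTE nzz) orbF => /eqP.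
have {v nz} [v [nz uv]] : exists v, det3 u v w != 0 /\ bil m u v = 0.
  have := combP (bil m u v) nz; move: (_ / _) (_ / _) (_ / _) => c k a e.
  have := nil_mul3 u u v; rewrite e !bilDr !bilZr wr e -/w => e1.
  have [_ k0 a0] : [/\ k * a = 0, k * k = 0 & a + k * c = 0].
    apply: (@comb_inj u v w _ _ _ 0 0 0 nz).
    by rewrite !scale0r !addr0 -e1; lin_ring.
  rewrite (sq0 _ k0) mul0r addr0 in a0.
  rewrite (sq0 _ k0) a0 !scale0r !add0r in e.
  exists (v - c *: u); split; last by rewrite bilDr bilNr bilZr e subrr.
  by rewrite (_ : det3 _ _ _ = det3 u v w) // /det3; col_simp; ring.
have [g vv] : exists g, bil m v v = g *: w.
  have := combP (bil m v v) nz; move: (_ / _) (_ / _) (_ / _) => g k a e; exists g.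
  have a0 : a = 0.
    apply: (sc0 _ _ nzw); rewrite -(nil_mul3 u v v) e !bilDr !bilZr wr uv -/w.
    by rewrite !scaler0 !addr0.
  have nzv : v != 0.
    by apply: contraNneq nz => ->; rewrite /det3; col_simp; apply/eqP; ring.
  rewrite a0 scale0r add0r in e.
  have [_ k0 _] : [/\ (0 : C) = 0, k * k = 0 & k * g = 0].
    apply: (@comb_inj u v w _ _ _ 0 0 0 nz).
    rewrite !scale0r !addr0 add0r -(nil_mul3 v v v) e bilDr !bilZr wr e; lin_ring.
  by rewrite e (sq0 _ k0) scale0r add0r.
have := combP (bil b u v) nz; move: (_ / _) (_ / _) (_ / _) => l k a e.
have wu : bil b w u = 0 by rewrite /w leib b_alt bil0l bil0r addr0.
have a0 : a = 0.
  apply: (sc0 _ _ nzw); have := leib u v u.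
  rewrite uv bil0l b_alt bil0l add0r (bN v u) bilNr e !bilDr !bilZr wr uv -/w.
  by rewrite !scaler0 !addr0 => /esym/eqP; rewrite oppr_eq0 => /eqP.
rewrite a0 scale0r add0r in e.
have wv : bil b w v = 0.
  by rewrite /w leib (mC _ u) e bilDr !bilZr wr uv !scaler0 !addr0.
have kg : k * g = 0.
  apply: (sc0 _ _ nzw); have := leib u v v.
  rewrite uv bil0l b_alt bil0r addr0 (mC _ v) e !bilDr !bilZr wr vv scaler0 addr0.
  by rewrite scalerA => <-.
have uw : bil b u w = 0 by rewrite bN wu oppr0.
have vw : bil b v w = 0 by rewrite bN wv oppr0.
have [k0|nzk] := eqVneq k 0.
  rewrite k0 scale0r add0r in e; right.
  by apply: (comp6_of_table Px nz (And5 _ uv (wr u) vv (conj (wr v) (wr w))) (And3 e uw vw)).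
left; have g0 : g = 0 by apply/eqP; move/eqP: kg; rewrite mulf_eq0 (negbTE nzk).
(* Absorbing [l w] into [v'] makes it an eigenvector of the bracket with [u]. *)
rewrite g0 scale0r in vv; pose v' := v + (l / k) *: w.
have nz' : det3 u v' w != 0.
  by rewrite (_ : det3 _ _ _ = det3 u v w) // /det3 /v'; col_simp; ring.
have uv' : bil m u v' = 0 by rewrite bilDr bilZr wr uv scaler0 addr0.
have vv' : bil m v' v' = 0 by rewrite bilDr bilZr wr mC bilDr bilZr wr vv !scaler0 !addr0.
have ev' : bil b u v' = k *: v'.
  by rewrite bilDr bilZr uw e scaler0 addr0 scalerDr scalerA mulrCA divff ?mulr1.
have vw' : bil b v' w = 0 by rewrite bilDl bilZl b_alt vw scaler0 addr0.
by apply: (comp4_of_square Px nz' nzk (And5 _ uv' (wr u) vv' (conj (wr v') (wr w)))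
  (And3 ev' uw vw')).
Qed.

Lemma mul_eq0_of_squares : (forall u, bil m u u = 0) -> forall u v, bil m u v = 0.
Proof.
move=> sq0 u v; apply: double_eq0; have := sq0 (u + v).
by rewrite !bilDl !bilDr !sq0 add0r addr0 (mC v).
Qed.

End Nil.

(* [v \times w] is proportional to [a], so [v] and [w] span the plane orthogonal to [a]. *)
Lemma orthogonal_plane (a : V) : a != 0 -> exists u v w k, det3 u v w != 0 /\
  forall y, det3 y v w = k * (a i0 0 * y i0 0 + a i1 0 * y i1 0 + a i2 0 * y i2 0).
Proof.
case/vec_neq0 => nz.
- exists (vec3 1 0 0), (vec3 (- a i1 0) (a i0 0) 0), (vec3 (- a i2 0) 0 (a i0 0)), (a i0 0).
  split=> [|y]; last by rewrite /det3; col_simp; ring.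
  rewrite (_ : det3 _ _ _ = a i0 0 * a i0 0) ?mulf_neq0 //.
  by rewrite /det3; col_simp; ring.
- exists (vec3 0 1 0), (vec3 (a i1 0) (- a i0 0) 0), (vec3 0 (- a i2 0) (a i1 0)), (- a i1 0).
  split=> [|y]; last by rewrite /det3; col_simp; ring.
  rewrite (_ : det3 _ _ _ = - (a i1 0 * a i1 0)) ?oppr_eq0 ?mulf_neq0 //.
  by rewrite /det3; col_simp; ring.
- exists (vec3 0 0 1), (vec3 (a i2 0) 0 (- a i0 0)), (vec3 0 (a i2 0) (- a i1 0)), (a i2 0).
  split=> [|y]; last by rewrite /det3; col_simp; ring.
  rewrite (_ : det3 _ _ _ = a i2 0 * a i2 0) ?mulf_neq0 //.
  by rewrite /det3; col_simp; ring.
Qed.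

Lemma cover_lie : (forall u v, bil m u v = 0) -> comp1 x \/ comp5 x.
Proof.
move=> m0; pose e0 := vec3 1 0 0; pose e1 := vec3 0 1 0; pose e2 := vec3 0 0 1.
(* The bracket is [y, z |-> M (y \times z)] with [M] the matrix of columns [p], [q], [r]. *)
have [p pE] : exists p, p = bil b e1 e2 by eexists.
have [q qE] : exists q, q = bil b e2 e0 by eexists.
have [r rE] : exists r, r = bil b e0 e1 by eexists.
have bE y z : bil b y z = (y i1 0 * z i2 0 - y i2 0 * z i1 0) *: p
    + (y i2 0 * z i0 0 - y i0 0 * z i2 0) *: q + (y i0 0 * z i1 0 - y i1 0 * z i0 0) *: r.
  have vE (t : V) : t = t i0 0 *: e0 + t i1 0 *: e1 + t i2 0 *: e2.
    by rewrite /e0 /e1 /e2; vec_ring.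
  rewrite {1}(vE y) {1}(vE z); bil_simp.
  rewrite !b_alt (bN e1 e0) (bN e2 e1) (bN e0 e2) -pE -qE -rE; lin_ring.
have nz0 : det3 e0 e1 e2 != 0.
  by rewrite (_ : det3 _ _ _ = 1) ?oner_eq0 // /det3 /e0 /e1 /e2; col_simp; ring.
(* Jacobi's identity says that [M] kills the axial vector [a] of its skew part. *)
pose a := vec3 (q i2 0 - r i1 0) (r i0 0 - p i2 0) (p i1 0 - q i0 0).
have Ma : a i0 0 *: p + a i1 0 *: q + a i2 0 *: r = 0.
  rewrite -(jacobi e0 e1 e2) -pE -qE -rE !bE /a /e0 /e1 /e2.
  by apply/colP => k; col_simp; ring.
have [a0|nza] := eqVneq a 0.
  left; have [a00 a01 a02] : [/\ q i2 0 - r i1 0 = 0, r i0 0 - p i2 0 = 0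
      & p i1 0 - q i0 0 = 0].
    have h k : a k 0 = 0 by rewrite a0 col_entry0.
    by have := (h i0, h i1, h i2); rewrite /a; col_simp => -[[-> ->] ->].
  move/eqP: a00; move/eqP: a01; move/eqP: a02; rewrite !subr_eq0.
  move=> /eqP pq /eqP rp /eqP qr.
  apply: (comp1_of_table Px nz0 (a0 := p i0 0) (b0 := p i1 0) (c0 := p i2 0)
    (d0 := q i1 0) (e0 := q i2 0) (f0 := r i2 0) m0); split; rewrite -/b.
  - by rewrite -rE -rp qr /e0 /e1 /e2; vec_ring.
  - by rewrite bN -qE pq /e0 /e1 /e2; vec_ring.
  - by rewrite -pE /e0 /e1 /e2; vec_ring.
right; have [u [v [w [k [nz aE]]]]] := orthogonal_plane nza.
(* The derived algebra is orthogonal to [a]: the skew part of [M] kills its own axial vector, so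
   [M^T a = M a = 0], and the scalar product of [a] with [M (y x z)] is that of [M^T a] with
   [y x z]. *)
have dotb y z : det3 (bil b y z) v w = 0.
  rewrite aE; have h i : a i0 0 * p i 0 + a i1 0 * q i 0 + a i2 0 * r i 0 = 0.
    by have := congr1 (fun t : V => t i 0) Ma; col_simp.
  move: (h i0) (h i1) (h i2); rewrite bE /a; col_simp => h0 h1 h2.
  transitivity (k *
    ((y i1 0 * z i2 0 - y i2 0 * z i1 0) *
       ((q i2 0 - r i1 0) * p i0 0 + (r i0 0 - p i2 0) * q i0 0 + (p i1 0 - q i0 0) * r i0 0)
    + (y i2 0 * z i0 0 - y i0 0 * z i2 0) *
       ((q i2 0 - r i1 0) * p i1 0 + (r i0 0 - p i2 0) * q i1 0 + (p i1 0 - q i0 0) * r i1 0)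
    + (y i0 0 * z i1 0 - y i1 0 * z i0 0) *
       ((q i2 0 - r i1 0) * p i2 0 + (r i0 0 - p i2 0) * q i2 0 + (p i1 0 - q i0 0) * r i2 0))).
    by ring.
  by rewrite h0 h1 h2 !mulr0 !addr0 mulr0.
(* The cross product of [v] and [w] is [k a], so their bracket is [k M a = 0]. *)
have vw : bil b v w = 0.
  have h0 : v i1 0 * w i2 0 - v i2 0 * w i1 0 = k * a i0 0.
    by transitivity (det3 e0 v w); [rewrite /det3|rewrite aE]; rewrite /e0; col_simp; ring.
  have h1 : v i2 0 * w i0 0 - v i0 0 * w i2 0 = k * a i1 0.
    by transitivity (det3 e1 v w); [rewrite /det3|rewrite aE]; rewrite /e1; col_simp; ring.
  have h2 : v i0 0 * w i1 0 - v i1 0 * w i0 0 = k * a i2 0.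
    by transitivity (det3 e2 v w); [rewrite /det3|rewrite aE]; rewrite /e2; col_simp; ring.
  by rewrite bE h0 h1 h2 -!scalerA -!scalerDr Ma scaler0.
have uv := combP (bil b u v) nz; rewrite dotb mul0r scale0r add0r in uv.
have uw := combP (bil b u w) nz; rewrite dotb mul0r scale0r add0r in uw.
exact: (comp5_of_table Px nz m0 (And3 uv uw vw)).
Qed.

End Classification.

Lemma P3_cover x : P3 x -> exists2 Z, List.In Z comps & Z x.
Proof.
move=> Px; have [[y nz]|h] := classic (exists y,
    det3 y (bil (pt_mul x) y y) (bil (pt_mul x) y (bil (pt_mul x) y y)) != 0).
  by exists comp2; [right; left|apply: (comp2_of_det3 Px nz)].
have noncyclic y :
    det3 y (bil (pt_mul x) y y) (bil (pt_mul x) y (bil (pt_mul x) y y)) = 0.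
  by apply/eqP; apply: contraT => nz; case: h; exists y.
have [[y nz]|nil] := classic (exists y,
    bil (pt_mul x) y (bil (pt_mul x) y y) != 0).
  have [u nzu uu] := ex_idempotent Px noncyclic nz.
  have [?|?] := cover_idempotent Px noncyclic nzu uu.
    by exists comp3; [do 2!right; left|].
  by exists comp4; [do 3!right; left|].
have nil3 y : bil (pt_mul x) y (bil (pt_mul x) y y) = 0.
  by apply/eqP; apply: contraT => nz; case: nil; exists y.
have [[u nz]|sq] := classic (exists u, bil (pt_mul x) u u != 0).
  have [?|?] := comp46_of_square Px nil3 nz.
    by exists comp4; [do 3!right; left|].
  by exists comp6; [do 5!right; left|].
have m0 : forall u v, bil (pt_mul x) u v = 0.
  apply: (mul_eq0_of_squares Px) => u.
  by apply/eqP; apply: contraT => nz; case: sq; exists u.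
have [?|?] := cover_lie Px m0; first by exists comp1; [left|].
by exists comp5; [do 4!right; left|].
Qed.

(** * Invariants separating the components *)

Lemma zclosed_ext A B : (forall x, A x <-> B x) -> zclosed A -> zclosed B.
Proof. by move=> AB [S AS]; exists S => x; rewrite -AB. Qed.

Definition vpolyfun (u : Pt -> V) := forall k, mpolyfun (fun x => u x k 0).

Lemma vpolyfun_cst u : vpolyfun (fun=> u).
Proof. by move=> k; apply: (funalg_cst funalg_mpolyfun). Qed.

Lemma vpolyfunD u v : vpolyfun u -> vpolyfun v -> vpolyfun (fun x => u x + v x).
Proof.
move=> Pu Pv k; apply: fun_transfer => [x|]; first by rewrite mxE.
exact: (funalgD funalg_mpolyfun).
Qed.

Lemma vpolyfunN u : vpolyfun u -> vpolyfun (fun x => - u x).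
Proof.
move=> Pu k; apply: fun_transfer => [x|]; first by rewrite mxE.
exact: (funalgN funalg_mpolyfun).
Qed.

Lemma vpolyfun_mul u v :
  vpolyfun u -> vpolyfun v -> vpolyfun (fun x => bil (pt_mul x) (u x) (v x)).
Proof.
move=> Pu Pv; apply: (funalg_bil funalg_mpolyfun) => // i j k; exact: mpolyfun_coord.
Qed.

Lemma vpolyfun_br u v :
  vpolyfun u -> vpolyfun v -> vpolyfun (fun x => bil (pt_br x) (u x) (v x)).
Proof.
move=> Pu Pv; apply: (funalg_bil funalg_mpolyfun) => // i j k; exact: mpolyfun_coord.
Qed.

Lemma mpolyfun_det3 u v w : vpolyfun u -> vpolyfun v -> vpolyfun w ->
  mpolyfun (fun x => det3 (u x) (v x) (w x)).
Proof.
move=> Pu Pv Pw; rewrite /det3.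
by do ?[apply: (funalgD funalg_mpolyfun) | apply: (funalgN funalg_mpolyfun)
  | apply: (funalgM funalg_mpolyfun)].
Qed.

Ltac mpolyfun_tac := repeat first
  [ apply: mpolyfun_det3 | apply: vpolyfun_cst | apply: vpolyfun_mul | apply: vpolyfun_br
  | apply: vpolyfunD | apply: vpolyfunN
  | apply: (funalg_cst funalg_mpolyfun)
  | apply: (funalgD funalg_mpolyfun) | apply: (funalgN funalg_mpolyfun)
  | apply: (funalgM funalg_mpolyfun) | apply: (funalgX funalg_mpolyfun) ].

Lemma zclosed_forall (I : Type) (A : I -> Pt -> Prop) :
  (forall i, zclosed (A i)) -> zclosed (fun x => forall i, A i x).
Proof.
move=> cA; exists (fun p => exists i, forall x, A i x -> p.@[x] = 0) => x; split.
  by move=> Ax p [i pA]; apply: pA; apply: Ax.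
move=> h i; have [S AS] := cA i; apply/AS => p Sp; apply: h; exists i => y.
by move/AS; apply.
Qed.

Lemma zclosed_eq0 f : mpolyfun f -> zclosed (fun x => f x = 0).
Proof.
move=> Pf; apply: zclosed_ext (zclosed_mpolyfun (fun _ : unit => Pf)) => x.
by split=> [/(_ tt)|].
Qed.

Lemma zclosed_veq0 u : vpolyfun u -> zclosed (fun x => u x = 0).
Proof.
move=> Pu; apply: zclosed_ext (zclosed_mpolyfun Pu) => x.
by split=> [h|-> k]; [apply/colP => k; rewrite h|]; rewrite mxE.
Qed.

Lemma zclosed_P3 : zclosed P3.
Proof.
apply: zclosed_forall => x; apply: zclosed_forall => y; apply: zclosed_forall => z.
apply: (@zclosed_ext (fun p =>
  bil (pt_mul p) x y - bil (pt_mul p) y x = 0 /\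
  bil (pt_mul p) (bil (pt_mul p) x y) z - bil (pt_mul p) x (bil (pt_mul p) y z) = 0 /\
  bil (pt_br p) x x = 0 /\
  bil (pt_br p) x (bil (pt_br p) y z) + bil (pt_br p) y (bil (pt_br p) z x)
    + bil (pt_br p) z (bil (pt_br p) x y) = 0 /\
  bil (pt_br p) (bil (pt_mul p) x y) z
    - (bil (pt_mul p) (bil (pt_br p) x z) y + bil (pt_mul p) x (bil (pt_br p) y z)) = 0)).
  move=> p; split=> [[c [a [s [j l]]]] | [c a s j l]].
    by split=> //; apply/eqP; rewrite -subr_eq0; apply/eqP.
  by do 4?[split=> //]; apply/eqP; rewrite subr_eq0; apply/eqP.
by do 4?apply: zclosedI; apply: zclosed_veq0; mpolyfun_tac.
Qed.

Definition zero_product (m : consts) := forall u v, bil m u v = 0.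
(** The sum equals the trace of the bracket with [y] times [det3 u v w]. *)
Definition unimodular (b : consts) := forall y u v w,
  det3 (bil b y u) v w + det3 u (bil b y v) w + det3 u v (bil b y w) = 0.
(* [tr(L)^2 = 3 e_2(L)] for every multiplication operator [L]. *)
Definition trace_condition (m : consts) := forall y u v w,
  (det3 (bil m y u) v w + det3 u (bil m y v) w + det3 u v (bil m y w)) ^+ 2
  - (det3 (bil m y u) (bil m y v) w + det3 (bil m y u) v (bil m y w)
     + det3 u (bil m y v) (bil m y w)) * 3%:R * det3 u v w = 0.
Definition derived_dim_le1 (b : consts) := forall y z s t u,
  det3 (bil b y z) (bil b s t) u = 0.
Definition derived_dim_le2 (b : consts) := forall y z s t u v,
  det3 (bil b y z) (bil b s t) (bil b u v) = 0.
(* Holds if [m y z] is [f y * f z *: c] modulo [<y, z>] for a linear form [f]. *)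
Definition decomposable_mod_span (m : consts) := forall y z,
  det3 y z (bil m y y) * det3 y z (bil m z z) - det3 y z (bil m y z) ^+ 2 = 0.
(* Holds if [m y z = f y * f z *: c] for a linear form [f]. *)
Definition decomposable (m : consts) := forall s t y z,
  det3 s t (bil m y y) * det3 s t (bil m z z) - det3 s t (bil m y z) ^+ 2 = 0.
Definition nilpotent2 (m : consts) := forall y z t, bil m y (bil m z t) = 0.

(** Each [inv] holds on the component with the same number and fails at the chosen representatives
    of the other five; conjunctions appear where one condition does not exclude them all. *)
Definition inv1 m b := zero_product m /\ unimodular b.
Definition inv2 (m b : consts) := zero_product b.
Definition inv3 m b :=
  [/\ trace_condition m, derived_dim_le1 b & decomposable_mod_span m].
Definition inv4 m b := derived_dim_le1 b /\ decomposable m.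
Definition inv5 m b := zero_product m /\ derived_dim_le2 b.
Definition inv6 m b := nilpotent2 m /\ nilpotent2 b.

Definition closed_cond (J : consts -> consts -> Prop) :=
  zclosed (fun x => J (pt_mul x) (pt_br x)).

Ltac zclosed_tac := rewrite /closed_cond;
  repeat (apply: zclosed_forall; intro);
  first [apply: zclosed_veq0 | apply: zclosed_eq0]; mpolyfun_tac.

Lemma closed_inv1 : closed_cond inv1.
Proof. by apply: zclosedI; zclosed_tac. Qed.

Lemma closed_inv2 : closed_cond inv2.
Proof. by zclosed_tac. Qed.

Lemma closed_inv3 : closed_cond inv3.
Proof.
apply: (@zclosed_ext (fun x => trace_condition (pt_mul x) /\
  derived_dim_le1 (pt_br x) /\ decomposable_mod_span (pt_mul x))).
  by move=> x; split=> [[? [? ?]]|[]].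
by do 2?apply: zclosedI; zclosed_tac.
Qed.

Lemma closed_inv4 : closed_cond inv4.
Proof. by apply: zclosedI; zclosed_tac. Qed.

Lemma closed_inv5 : closed_cond inv5.
Proof. by apply: zclosedI; zclosed_tac. Qed.

Lemma closed_inv6 : closed_cond inv6.
Proof. by apply: zclosedI; zclosed_tac. Qed.

(** * Invariance under isomorphism: the [det3] conditions only gain a power of [\det g] *)

Definition iso_cond (J : consts -> consts -> Prop) :=
  forall m b m' b', iso m b m' b' -> J m b -> J m' b'.

Ltac transport ug y := rewrite -(mulKVmx ug y); move: (_ *m y) => {}y.

Ltac push_tac em eb := repeat match goal with
  | |- context [bil ?m (?g *m ?u) (?g *m ?v)] => first [rewrite (em u v) | rewrite (eb u v)]
  end; rewrite ?det3_mulmx.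

Ltac scaled_tac c H := rewrite -[RHS](mulr0 c) -H; ring.

Section Transport.
Variables (m b m' b' : consts) (g : 'M[C]_3).
Hypothesis ug : g \in unitmx.
Hypothesis em : forall u v, bil m' (g *m u) (g *m v) = g *m bil m u v.
Hypothesis eb : forall u v, bil b' (g *m u) (g *m v) = g *m bil b u v.

Lemma transport_zero_product : zero_product m -> zero_product m'.
Proof.
move=> H u v; transport ug u; transport ug v; push_tac em em.
by rewrite H mulmx0.
Qed.

Lemma transport_unimodular : unimodular b -> unimodular b'.
Proof.
move=> H y u v w; transport ug y; transport ug u; transport ug v; transport ug w.
by push_tac eb eb; scaled_tac (\det g) (H y u v w).
Qed.

Lemma transport_trace_condition : trace_condition m -> trace_condition m'.
Proof.
move=> H y u v w; transport ug y; transport ug u; transport ug v; transport ug w.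
by push_tac em em; scaled_tac (\det g ^+ 2) (H y u v w).
Qed.

Lemma transport_derived_dim_le1 : derived_dim_le1 b -> derived_dim_le1 b'.
Proof.
move=> H y z s t u; transport ug y; transport ug z; transport ug s; transport ug t.
by transport ug u; push_tac eb eb; rewrite H mulr0.
Qed.

Lemma transport_derived_dim_le2 : derived_dim_le2 b -> derived_dim_le2 b'.
Proof.
move=> H y z s t u v; transport ug y; transport ug z; transport ug s; transport ug t.
by transport ug u; transport ug v; push_tac eb eb; rewrite H mulr0.
Qed.

Lemma transport_decomposable_mod_span :
  decomposable_mod_span m -> decomposable_mod_span m'.
Proof.
move=> H y z; transport ug y; transport ug z.
by push_tac em em; scaled_tac (\det g ^+ 2) (H y z).
Qed.

Lemma transport_decomposable : decomposable m -> decomposable m'.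
Proof.
move=> H s t y z; transport ug s; transport ug t; transport ug y; transport ug z.
by push_tac em em; scaled_tac (\det g ^+ 2) (H s t y z).
Qed.

Lemma transport_nilpotent2 : nilpotent2 m -> nilpotent2 m'.
Proof.
move=> H y z t; transport ug y; transport ug z; transport ug t; push_tac em em.
by rewrite H mulmx0.
Qed.

End Transport.

Lemma iso_bil m b m' b' : iso m b m' b' -> exists g, [/\ g \in unitmx,
    forall u v, bil m' (g *m u) (g *m v) = g *m bil m u v &
    forall u v, bil b' (g *m u) (g *m v) = g *m bil b u v].
Proof. by move=> [g ug h]; exists g; split=> // u v; have [] := h u v. Qed.

Lemma iso_inv1 : iso_cond inv1.
Proof.
move=> m b m' b' /iso_bil[g [ug em eb]] [H1 H2]; split.
- exact: transport_zero_product em H1.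
- exact: transport_unimodular eb H2.
Qed.

Lemma iso_inv2 : iso_cond inv2.
Proof. by move=> m b m' b' /iso_bil[g [ug em eb]]; apply: transport_zero_product eb. Qed.

Lemma iso_inv3 : iso_cond inv3.
Proof.
move=> m b m' b' /iso_bil[g [ug em eb]] [H1 H2 H3]; split.
- exact: transport_trace_condition em H1.
- exact: transport_derived_dim_le1 eb H2.
- exact: transport_decomposable_mod_span em H3.
Qed.

Lemma iso_inv4 : iso_cond inv4.
Proof.
move=> m b m' b' /iso_bil[g [ug em eb]] [H1 H2]; split.
- exact: transport_derived_dim_le1 eb H1.
- exact: transport_decomposable em H2.
Qed.

Lemma iso_inv5 : iso_cond inv5.
Proof.
move=> m b m' b' /iso_bil[g [ug em eb]] [H1 H2]; split.
- exact: transport_zero_product em H1.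
- exact: transport_derived_dim_le2 eb H2.
Qed.

Lemma iso_inv6 : iso_cond inv6.
Proof.
move=> m b m' b' /iso_bil[g [ug em eb]] [H1 H2]; split.
- exact: transport_nilpotent2 em H1.
- exact: transport_nilpotent2 eb H2.
Qed.

(** Reduces containment of a whole component to a check on the representatives; it serves for the
    separating invariants and for [is_poisson] itself. *)
Lemma zclosure_orbits_cond J mu br : closed_cond J -> iso_cond J ->
  (forall a, J (mu a) (br a)) ->
  subset (zclosure (orbits mu br)) (fun x => J (pt_mul x) (pt_br x)).
Proof.
move=> cJ iJ h; apply: zclosure_min => // x [a /orbit_iso ha].
exact: iJ ha (h a).
Qed.

(** * Values of the invariants at the representatives *)

Lemma bil_zero_c u v : bil zero_c u v = 0.
Proof. by rewrite zero_symtE; table_tac; ring. Qed.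

Lemma bil_P34_br a u v : bil (P34_br a) u v =
  vec3 0 (u i0 0 * v i1 0 - u i1 0 * v i0 0) (a * (u i0 0 * v i2 0 - u i2 0 * v i0 0)).
Proof. by rewrite P34_brE; table_tac; ring. Qed.

Lemma bil_P35_br u v : bil P35_br u v =
  vec3 (-2 * (u i0 0 * v i2 0 - u i2 0 * v i0 0))
    (2 * (u i1 0 * v i2 0 - u i2 0 * v i1 0)) (u i0 0 * v i1 0 - u i1 0 * v i0 0).
Proof. by rewrite P35_brE; table_tac; ring. Qed.

Lemma bil_P37_mul u v :
  bil P37_mul u v = vec3 (u i0 0 * v i0 0) (u i1 0 * v i1 0) (u i2 0 * v i2 0).
Proof. by rewrite P37_mulE; table_tac; ring. Qed.

Lemma bil_P316_mul a u v :
  bil (P316_mul a) u v = vec3 0 0 (u i0 0 * v i1 0 + u i1 0 * v i0 0).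
Proof. by rewrite P316_mulE; table_tac; ring. Qed.

Lemma bil_P316_br a u v :
  bil (P316_br a) u v = vec3 0 0 (a * (u i0 0 * v i1 0 - u i1 0 * v i0 0)).
Proof. by rewrite P316_brE; table_tac; ring. Qed.

Lemma bil_P318_mul u v : bil P318_mul u v = vec3 (u i0 0 * v i0 0)
  (u i0 0 * v i1 0 + u i1 0 * v i0 0) (u i0 0 * v i2 0 + u i2 0 * v i0 0).
Proof. by rewrite P318_mulE; table_tac; ring. Qed.

Lemma bil_P318_br u v :
  bil P318_br u v = vec3 0 (u i1 0 * v i2 0 - u i2 0 * v i1 0) 0.
Proof. by rewrite P318_brE; table_tac; ring. Qed.

Lemma bil_P320_mul u v : bil P320_mul u v = vec3 (u i0 0 * v i0 0) 0 0.
Proof. by rewrite P320_mulE; table_tac; ring. Qed.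

Lemma bil_P320_br u v :
  bil P320_br u v = vec3 0 (u i1 0 * v i2 0 - u i2 0 * v i1 0) 0.
Proof. exact: bil_P318_br. Qed.

Hint Rewrite bil_zero_c bil_P34_br bil_P35_br bil_P37_mul bil_P316_mul bil_P316_br
  bil_P318_mul bil_P318_br bil_P320_mul bil_P320_br : repE.

Ltac rep_tac := rewrite /det3; autorewrite with repE; col_simp; ring.
Ltac rep_vec_tac := autorewrite with repE; vec_ring.

Lemma inv1_rep : inv1 P35_mul P35_br.
Proof. by split; [exact: bil_zero_c | move=> y u v w; rep_tac]. Qed.

Lemma inv2_rep : inv2 P37_mul P37_br.
Proof. exact: bil_zero_c. Qed.

Lemma inv3_rep : inv3 P318_mul P318_br.
Proof.
split.
(* Multiplication by [y] has the single eigenvalue [y i0 0], so its trace is three times this value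
   and its second elementary symmetric function three times the square. *)
- move=> y u v w; set L := bil _.
  have -> : det3 (L y u) v w + det3 u (L y v) w + det3 u v (L y w) = 3%:R * y i0 0 * det3 u v w.
    by rewrite /L; rep_tac.
  have -> : det3 (L y u) (L y v) w + det3 (L y u) v (L y w) + det3 u (L y v) (L y w)
      = 3%:R * y i0 0 ^+ 2 * det3 u v w.
    by rewrite /L; rep_tac.
  by ring.
- by move=> y z s t u; rep_tac.
- by move=> y z; rep_tac.
Qed.

Lemma inv4_rep : inv4 P320_mul P320_br.
Proof. by split=> [y z s t u | s t y z]; rep_tac. Qed.

Lemma inv5_rep a : inv5 (P34_mul a) (P34_br a).
Proof. by split; [exact: bil_zero_c | move=> y z s t u v; rep_tac]. Qed.

Lemma inv6_rep a : inv6 (P316_mul a) (P316_br a).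
Proof. by split=> y z t; rep_vec_tac. Qed.

Ltac poisson_tac :=
  move=> x y z; split; rewrite ?/P35_mul ?/P37_br ?/P34_mul; rep_vec_tac.

Lemma poisson_rep1 : is_poisson P35_mul P35_br. Proof. poisson_tac. Qed.
Lemma poisson_rep2 : is_poisson P37_mul P37_br. Proof. poisson_tac. Qed.
Lemma poisson_rep3 : is_poisson P318_mul P318_br. Proof. poisson_tac. Qed.
Lemma poisson_rep4 : is_poisson P320_mul P320_br. Proof. poisson_tac. Qed.
Lemma poisson_rep5 a : is_poisson (P34_mul a) (P34_br a). Proof. poisson_tac. Qed.
Lemma poisson_rep6 a : is_poisson (P316_mul a) (P316_br a). Proof. poisson_tac. Qed.

Lemma natC_absurd n : (n.+1%:R : C) = 0 -> False.
Proof. by move/eqP; rewrite (negbTE (natC_neq0 n)). Qed.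

Lemma natCN_absurd n : (- n.+1%:R : C) = 0 -> False.
Proof. by move/eqP; rewrite oppr_eq0 => /eqP/natC_absurd. Qed.

Local Notation e0 := (vec3 1 0 0).
Local Notation e1 := (vec3 0 1 0).
Local Notation e2 := (vec3 0 0 1).

Lemma product_neq0 m u v k : bil m u v k 0 = 1 -> ~ zero_product m.
Proof. by move=> e H; move/eqP: e; rewrite H mxE eq_sym oner_eq0. Qed.

Ltac product_neq0_tac := autorewrite with repE; col_simp; ring.

Lemma P37_mul_neq0 : ~ zero_product P37_mul.
Proof. by apply: (@product_neq0 _ e0 e0 i0); product_neq0_tac. Qed.
Lemma P318_mul_neq0 : ~ zero_product P318_mul.
Proof. by apply: (@product_neq0 _ e0 e0 i0); product_neq0_tac. Qed.
Lemma P320_mul_neq0 : ~ zero_product P320_mul.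
Proof. by apply: (@product_neq0 _ e0 e0 i0); product_neq0_tac. Qed.
Lemma P316_mul_neq0 a : ~ zero_product (P316_mul a).
Proof. by apply: (@product_neq0 _ e0 e1 i2); product_neq0_tac. Qed.
Lemma P35_br_neq0 : ~ zero_product P35_br.
Proof. by apply: (@product_neq0 _ e0 e1 i2); product_neq0_tac. Qed.
Lemma P318_br_neq0 : ~ zero_product P318_br.
Proof. by apply: (@product_neq0 _ e1 e2 i1); product_neq0_tac. Qed.
Lemma P320_br_neq0 : ~ zero_product P320_br.
Proof. by apply: (@product_neq0 _ e1 e2 i1); product_neq0_tac. Qed.
Lemma P34_br_neq0 a : ~ zero_product (P34_br a).
Proof. by apply: (@product_neq0 _ e0 e1 i1); product_neq0_tac. Qed.
Lemma P316_br_neq0 : ~ zero_product (P316_br 1).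
Proof. by apply: (@product_neq0 _ e0 e1 i2); product_neq0_tac. Qed.

Lemma P34_not_unimodular : ~ unimodular (P34_br 1).
Proof.
move=> H; apply: (@natC_absurd 1); rewrite -[RHS](H e0 e0 e1 e2); rep_tac.
Qed.

Lemma P37_trace : ~ trace_condition P37_mul.
Proof.
move=> H; apply: (@natC_absurd 0); rewrite -[RHS](H e0 e0 e1 e2); rep_tac.
Qed.

Lemma P320_trace : ~ trace_condition P320_mul.
Proof.
move=> H; apply: (@natC_absurd 0); rewrite -[RHS](H e0 e0 e1 e2); rep_tac.
Qed.

Lemma P35_derived : ~ derived_dim_le2 P35_br.
Proof.
move=> H; apply: (@natC_absurd 3); rewrite -[RHS](H e0 e1 e2 e0 e1 e2); rep_tac.
Qed.

Lemma P35_derived1 : ~ derived_dim_le1 P35_br.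
Proof. by move=> H; apply: P35_derived => y z s t u v; apply: H. Qed.

Lemma P34_derived1 : ~ derived_dim_le1 (P34_br 1).
Proof.
move=> H; apply: (@natC_absurd 0); rewrite -[RHS](H e0 e1 e0 e2 e0); rep_tac.
Qed.

Lemma P316_mod_span a : ~ decomposable_mod_span (P316_mul a).
Proof.
move=> H; apply: (@natCN_absurd 0); rewrite -[RHS](H e0 e1); rep_tac.
Qed.

Lemma P37_not_decomposable : ~ decomposable P37_mul.
Proof.
move=> H; apply: (@natC_absurd 0).
(* The linear form given by these two columns is the sum of the first two coordinates: it takes the
   value 1 on the idempotents [e0] and [e1], whose product is zero. *)
by rewrite -[RHS](H e2 (vec3 1 (-1) 0) e0 e1); rep_tac.
Qed.

Lemma P318_not_decomposable : ~ decomposable P318_mul.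
Proof.
move=> H; apply: (@natCN_absurd 0); rewrite -[RHS](H e0 e2 e0 e1); rep_tac.
Qed.

Lemma P316_not_decomposable a : ~ decomposable (P316_mul a).
Proof. by move=> H; apply: (@P316_mod_span a) => y z; apply: H. Qed.

Lemma not_nilpotent2 m u v w k : bil m u (bil m v w) k 0 = 1 -> ~ nilpotent2 m.
Proof. by move=> e H; move/eqP: e; rewrite H mxE eq_sym oner_eq0. Qed.

Lemma P35_not_nilpotent : ~ nilpotent2 P35_br.
Proof.
have nz2 : (2 : C) != 0 by apply: natC_neq0.
apply: (@not_nilpotent2 _ (vec3 0 2^-1 0) e0 e2 i2).
by autorewrite with repE; col_simp; field.
Qed.
Lemma P37_not_nilpotent : ~ nilpotent2 P37_mul.
Proof. by apply: (@not_nilpotent2 _ e0 e0 e0 i0); product_neq0_tac. Qed.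
Lemma P318_not_nilpotent : ~ nilpotent2 P318_mul.
Proof. by apply: (@not_nilpotent2 _ e0 e0 e0 i0); product_neq0_tac. Qed.
Lemma P320_not_nilpotent : ~ nilpotent2 P320_mul.
Proof. by apply: (@not_nilpotent2 _ e0 e0 e0 i0); product_neq0_tac. Qed.
Lemma P34_not_nilpotent a : ~ nilpotent2 (P34_br a).
Proof. by apply: (@not_nilpotent2 _ e0 e0 e1 i1); product_neq0_tac. Qed.

Definition invs := [:: inv1; inv2; inv3; inv4; inv5; inv6].
(** The parameter 1 avoids special members: [P34_br (-1)] is unimodular, [P34_br 0] has a
    one-dimensional derived algebra, and [P316_br 0] is zero. *)
Definition rep_muls := [:: P35_mul; P37_mul; P318_mul; P320_mul; P34_mul 1; P316_mul 1].
Definition rep_brs := [:: P35_br; P37_br; P318_br; P320_br; P34_br 1; P316_br 1].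

Lemma rep_not_inv (i j : 'I_6) :
  nth inv1 invs j (nth zero_c rep_muls i) (nth zero_c rep_brs i) -> i = j.
Proof.
case: i => [[|[|[|[|[|[|i]]]]]] //= lt_i]; case: j => [[|[|[|[|[|[|j]]]]]] //= lt_j];
  try (by move=> _; apply: val_inj).
- by move/P35_br_neq0.
- by case=> _ /P35_derived1.
- by case=> /P35_derived1.
- by case=> _ /P35_derived.
- by case=> _ /P35_not_nilpotent.
- by case=> /P37_mul_neq0.
- by case=> /P37_trace.
- by case=> _ /P37_not_decomposable.
- by case=> /P37_mul_neq0.
- by case=> /P37_not_nilpotent.
- by case=> /P318_mul_neq0.
- by move/P318_br_neq0.
- by case=> _ /P318_not_decomposable.
- by case=> /P318_mul_neq0.
- by case=> /P318_not_nilpotent.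
- by case=> /P320_mul_neq0.
- by move/P320_br_neq0.
- by case=> /P320_trace.
- by case=> /P320_mul_neq0.
- by case=> /P320_not_nilpotent.
- by case=> _ /P34_not_unimodular.
- by move/P34_br_neq0.
- by case=> _ /P34_derived1.
- by case=> /P34_derived1.
- by case=> _ /P34_not_nilpotent.
- by case=> /P316_mul_neq0.
- by move/P316_br_neq0.
- by case=> _ _ /P316_mod_span.
- by case=> _ /P316_not_decomposable.
- by case=> /P316_mul_neq0.
Qed.

Lemma comps_inv (j : 'I_6) :
  subset (nth comp1 comps j) (fun x => nth inv1 invs j (pt_mul x) (pt_br x)).
Proof.
case: j => [[|[|[|[|[|[|j]]]]]] //= _];
  rewrite /comp1 /comp2 /comp3 /comp4 ?orbit_as_orbits; apply: zclosure_orbits_cond => //.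
- exact: closed_inv1.
- exact: iso_inv1.
- by move=> _; exact: inv1_rep.
- exact: closed_inv2.
- exact: iso_inv2.
- by move=> _; exact: inv2_rep.
- exact: closed_inv3.
- exact: iso_inv3.
- by move=> _; exact: inv3_rep.
- exact: closed_inv4.
- exact: iso_inv4.
- by move=> _; exact: inv4_rep.
- exact: closed_inv5.
- exact: iso_inv5.
- exact: inv5_rep.
- exact: closed_inv6.
- exact: iso_inv6.
- exact: inv6_rep.
Qed.

Lemma comps_rep (i : 'I_6) :
  nth comp1 comps i (mkpt (nth zero_c rep_muls i) (nth zero_c rep_brs i)).
Proof.
case: i => [[|[|[|[|[|[|i]]]]]] //= _]; apply: zclosure_sub;
  (first [apply/orbit_iso | exists 1; apply/orbit_iso]);
  by rewrite pt_mulK pt_brK; apply: iso_refl.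
Qed.

Lemma comps_incomparable (i j : 'I_6) :
  subset (nth comp1 comps i) (nth comp1 comps j) -> i = j.
Proof.
move=> sub; apply: rep_not_inv.
by have := comps_inv (sub _ (comps_rep i)); rewrite pt_mulK pt_brK.
Qed.

Lemma In_comps Z : List.In Z comps -> exists i : 'I_6, Z = nth comp1 comps i.
Proof.
by case=> [|[|[|[|[|[|[]]]]]]] <-; [exists (inord 0)|exists (inord 1)|exists (inord 2)
  |exists (inord 3)|exists (inord 4)|exists (inord 5)]; rewrite inordK.
Qed.

(** Puts the four single orbits and the two families in one form, so that closedness, irreducibility
    and inclusion in [P3] are proved uniformly. *)
Lemma comps_zclosure (i : 'I_6) : exists mu br,
  [/\ nth comp1 comps i = zclosure (orbits mu br), polyconsts mu, polyconsts br &
      forall a, is_poisson (mu a) (br a)].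
Proof.
have cst (m : consts) : polyconsts (fun=> m).
  by move=> ? ? ?; apply: (funalg_cst funalg_polyfun).
case: i => [[|[|[|[|[|[|i]]]]]] //= _].
- exists (fun=> P35_mul), (fun=> P35_br); rewrite -orbit_as_orbits.
  by split=> // _; apply: poisson_rep1.
- exists (fun=> P37_mul), (fun=> P37_br); rewrite -orbit_as_orbits.
  by split=> // _; apply: poisson_rep2.
- exists (fun=> P318_mul), (fun=> P318_br); rewrite -orbit_as_orbits.
  by split=> // _; apply: poisson_rep3.
- exists (fun=> P320_mul), (fun=> P320_br); rewrite -orbit_as_orbits.
  by split=> // _; apply: poisson_rep4.
- exists P34_mul, P34_br; split=> //; last exact: poisson_rep5.
    exact: (cst zero_c).
  by rewrite (functional_extensionality _ _ P34_brE); polyconsts_tac.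
- exists P316_mul, P316_br; split=> //; last exact: poisson_rep6.
    by rewrite (functional_extensionality _ _ P316_mulE); polyconsts_tac.
  by rewrite (functional_extensionality _ _ P316_brE); polyconsts_tac.
Qed.

(* P_3 has exactly six irreducible components: a subset is an irreducible
   component iff it equals one of the six listed closures, and the six
   listed sets are pairwise distinct. *)
Theorem theorem4p10 :
  (forall A, irr_component P3 A <-> exists2 Z, List.In Z comps & set_eq A Z) /\
  (forall i j : 'I_6, set_eq (nth comp1 comps i) (nth comp1 comps j) -> i = j).
Proof.
split; last by move=> i j e; apply: comps_incomparable => x /e.
apply: irr_components.
- move=> Z /In_comps[i ->]; have [mu [br [-> Pmu Pbr Pois]]] := comps_zclosure i.
  split; first exact: zclosed_zclosure.
    by apply: irreducible_zclosure; apply: irreducible_orbits.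
  exact: (zclosure_orbits_cond (J := is_poisson) zclosed_P3 is_poisson_iso Pois).
- exact: P3_cover.
- by move=> _ _ /In_comps[i ->] /In_comps[j ->] /comps_incomparable ->.
Qed.
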